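(* Let $0\le\beta<1$, and set $\widetilde L:=[e|\log p|]$, $\widetilde M:=[eNp|\log p|]$. Let $P^{\mathcal P-\mathcal P}_{N,\widetilde M,\widetilde L}$ be the distribution on $N\times\widetilde M$ binary matrices $C_{N,\widetilde M}=(c_{i,a})$ under which the entries $c_{i,a}$ are independent Bernoulli random variables with $\Pr(c_{i,a}=1)=\widetilde L/\widetilde M$, i.e. $P^{\mathcal P-\mathcal P}_{N,\widetilde M,\widetilde L}(C)=\prod_{a=1}^{\widetilde M}\prod_{i=1}^N(\widetilde L/\widetilde M)^{c_{i,a}}(1-\widetilde L/\widetilde M)^{1-c_{i,a}}$. Then $$\lim_{N\to\infty\vert\beta}\sum_{C_{N,\widetilde M}}P^{\mathcal P-\mathcal P}_{N,\widetilde M,\widetilde L}(C_{N,\widetilde M})\,\frac{T_{\widetilde M,C_{N,\widetilde M},p}}{Np|\log p|}=e.$$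
   Context: Probabilistic group testing with two-stage algorithms. For an integer $N\ge1$ and $p\in(0,1)$, a configuration $X=(x_1,\dots,x_N)\in\{0,1\}^N$ is drawn from $\mu_p(X)=\prod_{i} p^{x_i}(1-p)^{1-x_i}$. A first stage with $M$ tests is an $N\times M$ binary matrix $C_{N,M}=(c_{i,a})$; variable $i$ belongs to test $a$ iff $c_{i,a}=1$. Test outcome $T_a=0$ if $c_{i,a}x_i=0$ for all $i$, else $T_a=1$. Variable $i$ is a sure zero if some $a$ has $c_{i,a}=1$ and $T_a=0$; it is a sure one if $x_i=1$ and some $a$ with $c_{i,a}=1$ has every other $j$ with $c_{j,a}=1$ a sure zero. $\mathcal U_0$ is the set of $i$ with $x_i=0$ not sure zeros, $\mathcal U_1$ the set of $i$ with $x_i=1$ not sure ones. $T_{M,C_{N,M},p}:=M+\sum_X\mu_p(X)(|\mathcal U_0|+|\mathcal U_1|)$. $[x]$ denotes the integer part, $\log$ the natural logarithm. For $\beta>0$, $\lim_{N\to\infty\vert\beta}f(N,p):=\lim_{N\to\infty}f(N,N^{-\beta})$; for $\beta=0$, $\lim_{N\to\infty\vert 0}f(N,p):=\lim_{p\to0}\lim_{N\to\infty}f(N,p)$. *)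

(* Defs.v *)
From HB Require Import structures.
From mathcomp Require Import all_boot all_order all_algebra.
From mathcomp Require Import all_classical all_reals all_analysis.
Set Implicit Arguments. Unset Strict Implicit. Unset Printing Implicit Defensive.
Import Order.TTheory GRing.Theory Num.Theory.
Local Open Scope ring_scope.

Section GT.
Variables (R : realType) (N M : nat).
Implicit Types (C : 'M[bool]_(N, M)) (X : {ffun 'I_N -> bool}).

Definition outcome C X (a : 'I_M) : bool := [exists i, C i a && X i].

Definition sure_zero C X (i : 'I_N) : bool :=
  [exists a, C i a && ~~ outcome C X a].

Definition sure_one C X (i : 'I_N) : bool :=
  X i && [exists a, C i a &&
     [forall j, ((j != i) && C j a) ==> sure_zero C X j]].

Definition U0 C X : {set 'I_N} := [set i | ~~ X i && ~~ sure_zero C X i].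
Definition U1 C X : {set 'I_N} := [set i | X i && ~~ sure_one C X i].

Definition mu (p : R) X : R := \prod_(i < N) (if X i then p else 1 - p).

Definition Tcost C (p : R) : R :=
  M%:R + \sum_(X : {ffun 'I_N -> bool}) mu p X * (#|U0 C X| + #|U1 C X|)%:R.

Definition PPP (L : nat) C : R :=
  \prod_(a < M) \prod_(i < N)
     (if C i a then L%:R / M%:R else 1 - L%:R / M%:R).
End GT.

Definition Ltil (R : realType) (p : R) : nat := Num.truncn (expR 1 * `|ln p|).
Definition Mtil (R : realType) (N : nat) (p : R) : nat :=
  Num.truncn (expR 1 * N%:R * p * `|ln p|).

Definition avg_cost (R : realType) (N : nat) (p : R) : R :=
  \sum_(C : 'M[bool]_(N, Mtil N p))
     @PPP R N (Mtil N p) (Ltil p) C * (@Tcost R N (Mtil N p) C p / (N%:R * p * `|ln p|)).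

(* Main.v *)
Require Import Defs.
From HB Require Import structures.
From mathcomp Require Import all_boot all_order all_algebra.
From mathcomp Require Import all_classical all_reals all_analysis.
From mathcomp Require Import ring lra zify.
Import Order.TTheory GRing.Theory Num.Theory.
Import numFieldNormedType.Exports.
Local Open Scope ring_scope.

(* Write l = |ln p|, q = L/M, u = 1 - q, and let m be the number of ones.
   The first stage contributes M / (N p l) -> e, so it must be shown that U0 and
   U1 are negligible. For U1 this is free: |U1| is at most the number of ones,
   N p on average. A zero fails to be a sure zero with probability
   (1 - q u^m)^M <= exp (- L u^m); bounding u^m below by its tangent at m q = 1
   leaves an exponential moment of a binomial variable, and gives O(p) as soon as
   M >= 10 L^3. Altogether avg_cost = e + O(1/l), uniformly.

   For beta = 0 the limit in N at fixed p must moreover exist. Inclusion-exclusion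
   over the tests that would reveal i as a sure one, then over the zeros left
   undetermined in these tests, gives an exact formula for P(i in U1), because
   each term is a product over the independent columns of C. Its terms converge
   and are dominated by exponential series, so Tannery's theorem applies to each
   of the three nested sums. *)

(** * Expectations under the product measures on configurations and on matrices *)

Lemma sum_mu_prod (R : realType) (N : nat) (q : R) (g : 'I_N -> bool -> R) :
  \sum_(c : {ffun 'I_N -> bool}) mu q c * \prod_i g i (c i) =
  \prod_i (q * g i true + (1 - q) * g i false).
Proof.
transitivity (\prod_i \sum_b (if b then q else 1 - q) * g i b).
  by rewrite bigA_distr_bigA; apply: eq_bigr => c _; rewrite /mu -big_split.
by apply: eq_bigr => i _; rewrite big_bool.
Qed.

(** A random matrix is a family of independent columns, one per test, and each column has the law
    [mu] with parameter [L/M]. The same lemmas on [mu] thus serve both configurations and tests. *)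
Lemma sum_PPP_prod (R : realType) (N M L : nat)
    (f : 'I_M -> {ffun 'I_N -> bool} -> R) :
  \sum_(C : 'M[bool]_(N, M)) @PPP R N M L C * \prod_a f a [ffun i => C i a] =
  \prod_a \sum_(c : {ffun 'I_N -> bool}) mu (L%:R / M%:R) c * f a c.
Proof.
rewrite bigA_distr_bigA.
pose h (F : {ffun 'I_M -> {ffun 'I_N -> bool}}) : 'M[bool]_(N, M) :=
  \matrix_(i, a) F a i.
pose h' (C : 'M[bool]_(N, M)) : {ffun 'I_M -> {ffun 'I_N -> bool}} :=
  [ffun a => [ffun i => C i a]].
rewrite (reindex h) /=; last first.
  exists h' => [F _|C _]; first by apply/ffunP => a; apply/ffunP => i; rewrite !ffunE mxE.
  by apply/matrixP => i a; rewrite !mxE !ffunE.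
apply: eq_bigr => F _; rewrite /PPP -big_split /=; apply: eq_bigr => a _.
congr (_ * f a _); last by apply/ffunP => i; rewrite ffunE mxE.
by apply: eq_bigr => i _; rewrite mxE.
Qed.

Lemma sum_PPP (R : realType) (N M L : nat) :
  \sum_(C : 'M[bool]_(N, M)) @PPP R N M L C = 1.
Proof.
transitivity (\sum_(C : 'M[bool]_(N, M)) @PPP R N M L C * \prod_(a < M) 1).
  by apply: eq_bigr => C _; rewrite big1_eq mulr1.
rewrite (@sum_PPP_prod R N M L (fun _ _ => 1)) big1// => a _.
transitivity (\sum_(c : {ffun 'I_N -> bool}) mu (L%:R / M%:R : R) c * \prod_(i < N) 1).
  by apply: eq_bigr => c _; rewrite big1_eq.
rewrite (@sum_mu_prod R N (L%:R / M%:R) (fun _ _ => 1)) big1 // => i _.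
by rewrite !mulr1 addrC subrK.
Qed.

(** * Indicators, inclusion-exclusion and sums over subsets *)

Lemma indic_forall_prod (R : realType) (I : finType) (P : pred I) :
  ([forall i, P i])%:R = \prod_i (P i)%:R :> R.
Proof.
have [/forallP h|] := boolP [forall i, P i]; first by rewrite big1// => i _; rewrite h.
by rewrite negb_forall => /existsP[i /negbTE Pi]; rewrite (bigD1 i)//= Pi mul0r.
Qed.

(** Expand the product of one minus the indicator of [P], the set [B] collecting the factors where
    the indicator is chosen. The product runs over all of [I] with factor 1 outside [A], so sets not
    contained in [A] contribute 0. *)
Lemma indic_incl_excl (R : realType) (I : finType) (A : {set I}) (P : pred I) :
  ([forall i in A, ~~ P i])%:R =
  \sum_(B : {set I} | B \subset A) (-1) ^+ #|B| * ([forall i in B, P i])%:R :> R.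
Proof.
rewrite indic_forall_prod.
have -> : \prod_i ((i \in A) ==> ~~ P i)%:R =
   \prod_i (- ((i \in A) && P i)%:R + 1) :> R.
  by apply: eq_bigr => i _; case: (i \in A); case: (P i) => /=; rewrite ?oppr0 ?add0r ?addNr.
rewrite bigA_distr [RHS]big_mkcond /=; apply: eq_bigr => B _.
case: ifPn => [/fintype.subsetP BA|/fintype.subsetPn[i iB iA]]; last first.
  by rewrite (bigD1 i)//= iB (negbTE iA) oppr0 mul0r.
rewrite -big_mkcond/= prodrN; congr (_ * _).
rewrite indic_forall_prod [LHS]big_mkcond/=; apply: eq_bigr => i _.
by case: ifPn => [/[dup] iB /BA ->|].
Qed.

Lemma sum_subset_expr (R : realType) (I : finType) (A : {set I}) (x : R) :
  \sum_(B : {set I} | B \subset A) x ^+ #|B| = (1 + x) ^+ #|A|.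
Proof.
rewrite -[RHS]prodr_const [RHS]big_mkcond/=.
have -> : \prod_i (if i \in A then 1 + x else 1) =
          \prod_i ((if i \in A then x else 0) + 1) :> R.
  by apply: eq_bigr => i _; case: ifP => _; rewrite ?add0r// addrC.
rewrite bigA_distr [LHS]big_mkcond; apply: eq_bigr => B _.
case: ifPn => [/fintype.subsetP BA|/fintype.subsetPn[i iB iA]]; last first.
  by rewrite (bigD1 i)//= iB (negbTE iA) mul0r.
rewrite -prodr_const big_mkcond/=; apply: eq_bigr => i _.
by case: ifPn => // /BA ->.
Qed.

Lemma sum_subset_card (R : realType) (I : finType) (A : {set I}) (f : nat -> R) :
  \sum_(B : {set I} | B \subset A) f #|B| =
  \sum_(k < #|A|.+1) 'C(#|A|, k)%:R * f k.
Proof.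
(* Since |B| is at most |A|, [inord] keeps the value of the cardinality. *)
rewrite (partition_big (fun B : {set I} => inord #|B| : 'I_#|A|.+1) xpredT) //=.
apply: eq_bigr => k _.
rewrite (eq_bigl (fun B => B \in [set B : {set I} | B \subset A & #|B| == k])); last first.
  move=> B; rewrite inE; have [BA|//] /= := boolP (B \subset A).
  by rewrite -val_eqE/= inordK ?ltnS ?subset_leq_card.
rewrite (eq_bigr (fun=> f k)); last by move=> B; rewrite inE => /andP[_ /eqP ->].
by rewrite sumr_const cards_draws mulr_natl.
Qed.

(** * Probabilities of events on one column, and of missing a sure zero *)

Lemma sum_mu_avoid (R : realType) (N : nat) (q : R) (A : {set 'I_N}) :
  \sum_(c : {ffun 'I_N -> bool}) mu q c * ([forall i in A, ~~ c i])%:R = (1 - q) ^+ #|A|.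
Proof.
under eq_bigr do rewrite indic_forall_prod.
rewrite (@sum_mu_prod _ _ _ (fun i b => ((i \in A) ==> ~~ b)%:R)).
rewrite -prodr_const [RHS]big_mkcond; apply: eq_bigr => i _.
by case: ifP => _ /=; rewrite ?mulr0 ?mulr1 ?add0r// addrC subrK.
Qed.

Lemma sum_mu_hit_avoid (R : realType) (N : nat) (q : R) (i : 'I_N) (A : {set 'I_N}) :
  i \notin A ->
  \sum_(c : {ffun 'I_N -> bool}) mu q c * (c i && [forall j in A, ~~ c j])%:R =
  q * (1 - q) ^+ #|A|.
Proof.
move=> iA.
have E c : (c i && [forall j in A, ~~ c j])%:R =
   \prod_j (if j == i then (c j)%:R else ((j \in A) ==> ~~ c j)%:R) :> R.
  rewrite (bigD1 i)//= eqxx -mulnb natrM indic_forall_prod; congr (_ * _).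
  rewrite [LHS](bigD1 i)//= (negbTE iA) mul1r; apply: eq_bigr => j /negbTE ji.
  by rewrite ji.
under eq_bigr do rewrite E.
rewrite (@sum_mu_prod _ _ _ (fun j b => if j == i then b%:R else ((j \in A) ==> ~~ b)%:R)).
rewrite (bigD1 i)//= eqxx mulr1 mulr0 addr0; congr (_ * _).
rewrite -prodr_const [RHS]big_mkcond [RHS](bigD1 i)//= (negbTE iA) mul1r.
apply: eq_bigr => j /negbTE ->.
by case: ifP => _ /=; rewrite ?mulr0 ?mulr1 ?add0r// addrC subrK.
Qed.

Lemma sum_mu (R : realType) (N : nat) (q : R) :
  \sum_(c : {ffun 'I_N -> bool}) mu q c = 1.
Proof.
rewrite -(expr0 (1 - q)) -(cards0 'I_N) -sum_mu_avoid.
apply: eq_bigr => c _.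
have -> : [forall i in (finset.set0 : {set 'I_N}), ~~ c i].
  by apply/forallP => i; rewrite inE.
by rewrite mulr1.
Qed.

(** A test proves that i is a zero when it contains i and no one, which has probability q (1 - q)^m
    for m ones. The tests are independent and all M of them must fail. *)
Lemma sum_PPP_not_sure_zero (R : realType) (N M L : nat)
    (X : {ffun 'I_N -> bool}) (i : 'I_N) : ~~ X i ->
  let q : R := L%:R / M%:R in
  \sum_(C : 'M[bool]_(N, M)) @PPP R N M L C * (~~ sure_zero C X i)%:R =
  (1 - q * (1 - q) ^+ #|[set j | X j]%SET|) ^+ M.
Proof.
move=> Xi q; pose O := [set j | X j]%SET.
pose f (c : {ffun 'I_N -> bool}) : R := (~~ (c i && [forall j in O, ~~ c j]))%:R.
transitivity (\sum_(C : 'M[bool]_(N, M)) @PPP R N M L C *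
    \prod_a (fun=> f) a [ffun i => C i a]).
  apply: eq_bigr => C _; congr (_ * _).
  rewrite /sure_zero negb_exists indic_forall_prod; apply: eq_bigr => a _.
  rewrite /f ffunE /outcome; congr (~~ (_ && _))%:R.
  rewrite negb_exists; apply: eq_forallb => j; rewrite !ffunE inE.
  by case: (X j); rewrite ?andbT ?andbF.
rewrite (sum_PPP_prod _ _ _ _ (fun=> f)) prodr_const card_ord; congr (_ ^+ _).
rewrite -[X in X - _](@sum_mu R N q) -(sum_mu_hit_avoid _ _ _ i) ?inE// -sumrB.
by apply: eq_bigr => c _; rewrite /f; case: (_ && _); rewrite /= ?mulr0 ?mulr1 ?subr0 ?subrr.
Qed.

(** * Inclusion-exclusion for sure ones, at a fixed configuration *)

Lemma forall_in_and (I : finType) (A : {set I}) (P Q : pred I) :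
  [forall i in A, P i && Q i] = [forall i in A, P i] && [forall i in A, Q i].
Proof.
apply/forallP/andP => [h|[/forallP h1 /forallP h2] i].
  by split; apply/forallP => i; move: (h i); case: (i \in A) => //= /andP[].
by move: (h1 i) (h2 i); case: (i \in A) => //= -> ->.
Qed.

Lemma forall_in_U (I : finType) (A B : {set I}) (P : pred I) :
  [forall i in A :|: B, P i] = [forall i in A, P i] && [forall i in B, P i].
Proof.
apply/forallP/andP => [h|[/forallP h1 /forallP h2] i].
  by split; apply/forallP => i; move: (h i); rewrite inE;
     case: (i \in A); case: (i \in B).
by move: (h1 i) (h2 i); rewrite inE; case: (i \in A); case: (i \in B).
Qed.

Section NotSureOne.
Variables (N M : nat) (X : {ffun 'I_N -> bool}) (i : 'I_N).
Hypothesis Xi : X i.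
Let ones := [set j | X j]%SET.
Let zeros := [set j | ~~ X j]%SET.
Implicit Type C : 'M[bool]_(N, M).

Definition reveals C (a : 'I_M) : bool :=
  C i a && [forall j, ((j != i) && C j a) ==> sure_zero C X j].

(** The part of [reveals] that depends on column a alone. The rest, that the zeros of the test are
    sure zeros, involves the other columns. *)
Definition isolates C (a : 'I_M) : bool :=
  C i a && [forall j in ones :\ i, ~~ C j a].

Lemma one_not_sure_zero C j : X j -> ~~ sure_zero C X j.
Proof.
move=> Xj; apply/existsP => -[a /andP[Cja /negP]]; apply.
by apply/existsP; exists j; rewrite Cja.
Qed.

(** A one is never a sure zero, so a revealing test contains no one besides i. The remaining
    condition is regrouped zero by zero: each zero avoids all tests of [S] or is a sure zero. It is
    kept as a negated conjunction, the shape that [indic_incl_excl] expands. *)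
Lemma reveals_split C (S : {set 'I_M}) :
  [forall a in S, reveals C a] =
  [forall a in S, isolates C a] &&
  [forall j in zeros, ~~ (~~ [forall a in S, ~~ C j a] && ~~ sure_zero C X j)].
Proof.
apply/forallP/andP => [h|[/forallP h1 /forallP h2] a].
  split.
    apply/forallP => a; apply/implyP => aS; have /implyP/(_ aS)/andP[Cia /forallP h'] := h a.
    rewrite /isolates Cia; apply/forallP => j; apply/implyP; rewrite !inE => /andP[ji Xj].
    apply/negP => Cja; have := h' j; rewrite ji Cja /=; apply/negP.
    exact: one_not_sure_zero.
  apply/forallP => j; apply/implyP; rewrite inE => Xj.
  rewrite negb_and !negbK; case: (boolP [forall _ in _, _]) => //=.
  rewrite negb_forall => /existsP[a]; rewrite negb_imply negbK => /andP[aS Cja].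
  have /implyP/(_ aS)/andP[_ /forallP/(_ j)] := h a; rewrite Cja andbT => /implyP; apply.
  by apply: contraNneq Xj => ->.
apply/implyP => aS; have /implyP/(_ aS)/andP[Cia /forallP h'] := h1 a.
rewrite /reveals Cia; apply/forallP => j; apply/implyP => /andP[ji Cja].
have := h' j; rewrite !inE ji Cja /=; case: (boolP (X j)) => //= Xj _.
have := h2 j; rewrite inE Xj /= negb_and !negbK => /orP[/forallP/(_ a)|//].
by rewrite aS Cja.
Qed.

(** Tests of [S] contain the one i, hence have outcome 1 and can make nothing a sure zero. So the
    requirement that [A] has no sure zeros concerns only the tests outside [S], each of which must
    contain a one or miss [A]. The event thus becomes a conjunction of conditions on single
    columns. *)
Lemma reveals_columns C (S : {set 'I_M}) (A B : {set 'I_N}) :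
  [&& [forall a in S, isolates C a],
      [forall j in B, [forall a in S, ~~ C j a]] &
      [forall j in A, ~~ sure_zero C X j]] =
  [forall a, if a \in S
     then C i a && [forall j in (ones :\ i) :|: B, ~~ C j a]
     else ~~ ([forall j in ones, ~~ C j a] && ~~ [forall j in A, ~~ C j a])].
Proof.
apply/and3P/forallP => [[/forallP h1 /forallP h2 /forallP h3] a|h].
  case: ifPn => aS.
    have /implyP/(_ aS)/andP[-> /= hh] := h1 a.
    rewrite forall_in_U hh /=; apply/forallP => j; apply/implyP => jB.
    by have /implyP/(_ jB)/forallP/(_ a) := h2 j; rewrite aS.
  apply/negP => /andP[h4]; rewrite negb_forall => /existsP[j].
  rewrite negb_imply negbK => /andP[jA Cja].
  have /implyP/(_ jA)/negP := h3 j; apply; apply/existsP; exists a.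
  rewrite Cja /=; apply/existsP => -[k /andP[Cka Xk]].
  by move/forallP: h4 => /(_ k); rewrite inE Xk Cka.
split.
- apply/forallP => a; apply/implyP => aS; have := h a.
  by rewrite aS forall_in_U /isolates => /and3P[-> ->].
- apply/forallP => j; apply/implyP => jB; apply/forallP => a; apply/implyP => aS.
  have := h a; rewrite aS forall_in_U => /and3P[_ _ /forallP/(_ j)].
  by rewrite jB.
- apply/forallP => j; apply/implyP => jA; apply/existsP => -[a /andP[Cja]].
  rewrite /outcome negb_exists => /forallP h4; have := h a; case: ifPn => aS.
    by case/andP => Cia; have := h4 i; rewrite Cia Xi.
  move/negP; apply; apply/andP; split.
    apply/forallP => k; rewrite inE; apply/implyP => Xk.
    by have := h4 k; rewrite Xk andbT.
  by rewrite negb_forall; apply/existsP; exists j; rewrite jA Cja.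
Qed.

(** Three nested inclusion-exclusions: [S] for the tests that reveal i, [A] for the zeros that
    violate the second condition of [reveals_split], and [B] to rewrite that every element of [A] is
    touched by [S] in terms of elements avoiding [S]. *)
Lemma indic_not_sure_one (R : realType) C :
  (~~ sure_one C X i)%:R =
  \sum_(S : {set 'I_M} | S \subset finset.setT) (-1) ^+ #|S| *
  \sum_(A : {set 'I_N} | A \subset zeros) (-1) ^+ #|A| *
  \sum_(B : {set 'I_N} | B \subset A) (-1) ^+ #|B| *
  \prod_a (if a \in S
     then C i a && [forall j in (ones :\ i) :|: B, ~~ C j a]
     else ~~ ([forall j in ones, ~~ C j a] && ~~ [forall j in A, ~~ C j a]))%:R :> R.
Proof.
transitivity ([forall a in (finset.setT : {set 'I_M}), ~~ reveals C a]%:R : R).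
  congr (_%:R); rewrite /sure_one Xi /= negb_exists.
  by congr (nat_of_bool _); apply: eq_forallb => a; rewrite inE.
rewrite indic_incl_excl; apply: eq_bigr => S _; congr (_ * _).
rewrite reveals_split -mulnb natrM indic_incl_excl mulr_sumr.
apply: eq_bigr => A _; rewrite mulrCA; congr (_ * _).
rewrite forall_in_and -mulnb natrM indic_incl_excl mulrCA mulr_suml.
apply: eq_bigr => B _; rewrite -indic_forall_prod -reveals_columns.
rewrite -!mulnb !natrM; ring.
Qed.

(** A column in [S] has weight q (1 - q)^(m + |B|); a column outside [S] has the complementary
    weight of avoiding all m + 1 ones (i included) while hitting [A]. Only |B| then depends on [B],
    and the sum over [B] closes up by the binomial theorem. *)
Lemma sum_PPP_not_sure_one (R : realType) (L : nat) :
  let q : R := L%:R / M%:R in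
  let m := #|ones :\ i| in
  \sum_C @PPP R N M L C * (~~ sure_one C X i)%:R =
  \sum_(S : {set 'I_M} | S \subset finset.setT) (- (q * (1 - q) ^+ m)) ^+ #|S| *
  \sum_(A : {set 'I_N} | A \subset zeros) (- (1 - (1 - q) ^+ #|S|)) ^+ #|A| *
     (1 - (1 - q) ^+ m.+1 * (1 - (1 - q) ^+ #|A|)) ^+ (M - #|S|).
Proof.
move=> q m.
under eq_bigr => C _ do rewrite indic_not_sure_one mulr_sumr.
rewrite exchange_big /=; apply: eq_bigr => S _.
under eq_bigr => C _ do rewrite mulrCA mulr_sumr.
rewrite -mulr_sumr exchange_big /= [in RHS]exprNn -mulrA; congr (_ * _).
rewrite mulr_sumr; apply: eq_bigr => A Az.
under eq_bigr => C _ do rewrite mulrCA mulr_sumr.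
rewrite -mulr_sumr exchange_big /= [in RHS]exprNn -[X in _ = _ * X]mulrA [RHS]mulrCA; congr (_ * _).
pose b : R := 1 - (1 - q) ^+ m.+1 * (1 - (1 - q) ^+ #|A|).
transitivity (\sum_(B : {set 'I_N} | B \subset A) (- (1 - q) ^+ #|S|) ^+ #|B| *
   ((q * (1 - q) ^+ m) ^+ #|S| * b ^+ (M - #|S|))); last first.
  by rewrite -mulr_suml sum_subset_expr mulrCA.
apply: eq_bigr => B BA.
under eq_bigr => C _ do rewrite mulrCA.
rewrite -mulr_sumr [in RHS]exprNn -[RHS]mulrA; congr (_ * _).
pose f a (c : {ffun 'I_N -> bool}) : R := (if a \in S
     then c i && [forall j in (ones :\ i) :|: B, ~~ c j]
     else ~~ ([forall j in ones, ~~ c j] && ~~ [forall j in A, ~~ c j]))%:R.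
transitivity (\sum_C @PPP R N M L C * \prod_a f a [ffun i => C i a]).
  apply: eq_bigr => C _; congr (_ * _); apply: eq_bigr => a _.
  rewrite /f; have E P : [forall j in P, ~~ [ffun i0 => C i0 a] j] = [forall j in P, ~~ C j a].
    by apply: eq_forallb => j; rewrite ffunE.
  by rewrite ffunE !E.
rewrite sum_PPP_prod -/q.
have iB : i \notin (ones :\ i) :|: B.
  rewrite !inE eqxx /=; apply/negP => /(fintype.subsetP BA)/(fintype.subsetP Az).
  by rewrite inE Xi.
have dis (P Q : {set 'I_N}) : P \subset zeros -> Q \subset ones -> #|Q :|: P| = (#|Q| + #|P|)%N.
  move=> Pz Qo; apply/eqP; rewrite leq_card_setU.
  apply/pred0P => j /=; apply/negP => /andP[/(fintype.subsetP Qo) + /(fintype.subsetP Pz)].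
  by rewrite !inE => ->.
transitivity (\prod_a (if a \in S then q * (1 - q) ^+ (m + #|B|) else b)).
  apply: eq_bigr => a _; rewrite /f; case: ifP => aS.
    rewrite sum_mu_hit_avoid// dis//; first exact: (fintype.subset_trans BA).
    exact: finset.subsetDl.
  have mE : m.+1 = #|ones| by rewrite (finset.cardsD1 i ones) inE Xi.
  rewrite /b mE -[X in X - _](@sum_mu R N q) mulrBr mulr1 -exprD -dis//.
  rewrite -!sum_mu_avoid -!sumrB; apply: eq_bigr => c _; rewrite forall_in_U.
  by case: [forall _ in ones, _]; case: [forall _ in A, _];
    rewrite /= ?mulr0 ?mulr1 ?subrr ?subr0 ?subrr.
rewrite (bigID (mem S))/= (eq_bigr (fun=> q * (1 - q) ^+ (m + #|B|))); last by move=> a ->.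
rewrite prodr_const [X in _ * X](eq_bigr (fun=> b)); last by move=> a /negbTE ->.
rewrite prodr_const.
have -> : #|[pred a | a \notin S]| = (M - #|S|)%N.
  by rewrite -[X in (X - _)%N](card_ord M) -(cardC (mem S)) addKn.
rewrite exprD mulrA exprMn -!exprM [(#|B| * _)%N]mulnC; ring.
Qed.
End NotSureOne.

(** * Generating functions of the number of ones of a random configuration *)

Lemma expr_card_set (R : realType) (I : finType) (P : pred I) (t : R) :
  t ^+ #|[set j | P j]%SET| = \prod_j (if P j then t else 1).
Proof.
rewrite -prodr_const big_mkcond; apply: eq_bigr => j _.
by rewrite inE.
Qed.

Lemma sum_mu_expr (R : realType) (N : nat) (p t : R) :
  \sum_(X : {ffun 'I_N -> bool}) mu p X * t ^+ #|[set j | X j]%SET| =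
  (1 - p + p * t) ^+ N.
Proof.
under eq_bigr => X _ do rewrite expr_card_set.
rewrite (@sum_mu_prod R N p (fun _ b => if b then t else 1)) prodr_const card_ord.
by rewrite mulr1 addrC.
Qed.

Lemma sum_mu_zero_expr (R : realType) (N : nat) (p t : R) (i : 'I_N) :
  \sum_(X : {ffun 'I_N -> bool}) mu p X * ((~~ X i)%:R * t ^+ #|[set j | X j]%SET|) =
  (1 - p) * (1 - p + p * t) ^+ N.-1.
Proof.
pose g (j : 'I_N) (b : bool) : R := if j == i then (~~ b)%:R else if b then t else 1.
transitivity (\sum_(X : {ffun 'I_N -> bool}) mu p X * \prod_j g j (X j)).
  apply: eq_bigr => X _; congr (_ * _); rewrite expr_card_set.
  rewrite [RHS](bigD1 i)//= {1}/g eqxx (bigD1 i)//= mulrA; congr (_ * _).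
    by case: (X i); rewrite /= ?mulr1 ?mul0r.
  by apply: eq_bigr => j /negbTE ji; rewrite /g ji.
rewrite sum_mu_prod (bigD1 i)//= /g eqxx mulr0 add0r mulr1; congr (_ * _).
rewrite (eq_bigr (fun=> 1 - p + p * t)); last first.
  by move=> j /negbTE ->; rewrite mulr1 addrC.
by rewrite prodr_const cardC1 card_ord.
Qed.

(** The coordinate i contributes p, each element of [A] contributes 1 - p, and every other
    coordinate 1 - p + p t. If [A] contains i the event is empty, whence the indicator on the
    right. *)
Lemma sum_mu_one_expr (R : realType) (N : nat) (p t : R) (i : 'I_N) (A : {set 'I_N}) :
  \sum_(X : {ffun 'I_N -> bool}) mu p X *
    ((X i && (A \subset [set j | ~~ X j]%SET))%:R * t ^+ #|[set j | X j]%SET :\ i|) =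
  (A \subset [set~ i]%SET)%:R *
    (p * ((1 - p) ^+ #|A| * (1 - p + p * t) ^+ (N.-1 - #|A|))).
Proof.
have [Ai|] := boolP (A \subset [set~ i]%SET); last first.
  move=> /fintype.subsetPn[j jA]; rewrite !inE negbK => /eqP ji; subst j.
  rewrite mul0r big1// => X _.
  suff -> : (X i && (A \subset [set j | ~~ X j]%SET)) = false by rewrite mul0r mulr0.
  apply/negP => /andP[Xi /fintype.subsetP/(_ _ jA)].
  by rewrite inE Xi.
have iA : i \notin A by apply/negP => /(fintype.subsetP Ai); rewrite !inE eqxx.
pose g (j : 'I_N) (b : bool) : R := if j == i then b%:R else
   if j \in A then (~~ b)%:R else if b then t else 1.
transitivity (\sum_(X : {ffun 'I_N -> bool}) mu p X * \prod_j g j (X j)).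
  apply: eq_bigr => X _; congr (_ * _).
  have -> : [set j | X j]%SET :\ i = [set j | (j != i) && X j]%SET.
    by apply/setP => j; rewrite !inE.
  have -> : (A \subset [set j | ~~ X j]%SET) = [forall j, (j \in A) ==> ~~ X j].
    apply/fintype.subsetP/forallP => h j; last by have := h j; rewrite inE => /implyP.
    by apply/implyP => /h; rewrite inE.
  rewrite expr_card_set -mulnb natrM indic_forall_prod -mulrA -big_split /=.
  rewrite [RHS](bigD1 i)//= {1}/g eqxx [X in _ * X](bigD1 i)//= (negbTE iA) eqxx !mul1r.
  congr (_ * _); apply: eq_bigr => j /negbTE ji; rewrite /g ji.
  by case: (j \in A); case: (X j); rewrite /= ?mul1r ?mul0r ?mulr1.
rewrite sum_mu_prod (bigD1 i)//= /g eqxx mulr0 addr0 mulr1 mul1r; congr (_ * _).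
rewrite (bigID (mem A))/=; congr (_ * _).
  rewrite -prodr_const; apply: eq_big => j; last first.
    by move=> /andP[/negbTE -> ->]; rewrite mulr0 add0r mulr1.
  by case: eqP => [->|//]; rewrite (negbTE iA).
rewrite (eq_bigr (fun=> 1 - p + p * t)); last first.
  by move=> j /andP[/negbTE -> /negbTE ->]; rewrite mulr1 addrC.
rewrite prodr_const; congr (_ ^+ _).
have -> : N.-1 = #|[set~ i]%SET| by rewrite cardsC1 card_ord.
rewrite -(cardsID A [set~ i]%SET) (finset.setIidPr Ai) addKn.
by apply: eq_card => j; rewrite !inE unfold_in /= andbC.
Qed.

(** * Exact formulas for the expected numbers of undetermined variables *)

Lemma sum_sets_card (R : realType) (I : finType) (f : nat -> R) :
  \sum_(S : {set I} | S \subset finset.setT) f #|S| =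
  \sum_(k < #|I|.+1) 'C(#|I|, k)%:R * f k.
Proof. by rewrite sum_subset_card finset.cardsT. Qed.

Lemma expr_1B_sum (R : realType) (x : R) (n : nat) :
  (1 - x) ^+ n = \sum_(k < n.+1) 'C(n, k)%:R * (- x) ^+ k.
Proof.
rewrite exprDn; apply: eq_bigr => k _.
by rewrite expr1n mul1r mulr_natl.
Qed.

(* P(i in U0), for any i. *)
Definition mean_U0 (R : realType) (N M L : nat) (p : R) : R :=
  let q : R := L%:R / M%:R in
  \sum_(r < M.+1) 'C(M, r)%:R * (- q) ^+ r *
    ((1 - p) * (1 - p + p * (1 - q) ^+ r) ^+ N.-1).

(* P(i in U1), for any i: k counts tests revealing i, l zeros of these tests that
   are not sure zeros, and r comes from expanding (1 - u^m (1 - u^l))^(M - k) so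
   that the configuration can be averaged out. *)
Definition mean_U1 (R : realType) (N M L : nat) (p : R) : R :=
  let u : R := 1 - L%:R / M%:R in
  p * \sum_(k < M.+1) 'C(M, k)%:R * (- (1 - u)) ^+ k *
  \sum_(l < N.-1.+1) 'C(N.-1, l)%:R * (- ((1 - p) * (1 - u ^+ k))) ^+ l *
  \sum_(r < (M - k).+1) 'C(M - k, r)%:R * (- (u * (1 - u ^+ l))) ^+ r *
    (1 - p + p * u ^+ (k + r)) ^+ (N.-1 - l).

Lemma sum_mu_PPP_U0 (R : realType) (N M L : nat) (p : R) (i : 'I_N) :
  let q : R := L%:R / M%:R in
  \sum_(X : {ffun 'I_N -> bool}) mu p X *
    \sum_(C : 'M[bool]_(N, M)) @PPP R N M L C * (i \in U0 C X)%:R =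
  \sum_(X : {ffun 'I_N -> bool}) mu p X *
    ((~~ X i)%:R * (1 - q * (1 - q) ^+ #|[set j | X j]%SET|) ^+ M).
Proof.
move=> q; apply: eq_bigr => X _; congr (_ * _); have [Xi|Xi] /= := boolP (X i).
  by rewrite mul0r big1// => C _; rewrite inE Xi mulr0.
rewrite mul1r -(sum_PPP_not_sure_zero _ _ _ _ _ _ Xi); apply: eq_bigr => C _.
by rewrite inE Xi.
Qed.

(** Expanding (1 - q u^m)^M, where u = 1 - q, gives powers (u^r)^m of the number m of ones, whose
    average is the generating function at t = u^r. *)
Lemma mean_U0E (R : realType) (N M L : nat) (p : R) (i : 'I_N) :
  \sum_(X : {ffun 'I_N -> bool}) mu p X *
    \sum_(C : 'M[bool]_(N, M)) @PPP R N M L C * (i \in U0 C X)%:R =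
  mean_U0 R N M L p.
Proof.
rewrite sum_mu_PPP_U0; set q : R := L%:R / M%:R.
under eq_bigr => X _ do rewrite expr_1B_sum mulr_sumr mulr_sumr.
rewrite exchange_big /=; apply: eq_bigr => r _.
rewrite -(sum_mu_zero_expr _ _ _ _ i) mulr_sumr; apply: eq_bigr => X _.
rewrite -mulNr exprMn -!exprM [(r * _)%N]mulnC; ring.
Qed.

(** One more binomial expansion makes all exponents of u linear in the number of ones, so the
    configuration can be summed first. To exchange the sums, [A] runs over all sets and its
    inclusion in the zeros becomes an indicator. Afterwards only |S| and |A| matter, with [A]
    avoiding i: hence the coefficients from M and from N - 1. *)
Lemma mean_U1E (R : realType) (N M L : nat) (p : R) (i : 'I_N) :
  \sum_(X : {ffun 'I_N -> bool}) mu p X *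
    \sum_(C : 'M[bool]_(N, M)) @PPP R N M L C * (i \in U1 C X)%:R =
  mean_U1 R N M L p.
Proof.
set u : R := 1 - L%:R / M%:R.
have qE : L%:R / M%:R = 1 - u by rewrite /u opprB addrC subrK.
transitivity (\sum_(X : {ffun 'I_N -> bool}) 
    \sum_(S : {set 'I_M} | S \subset finset.setT)
    \sum_(A : {set 'I_N})
    \sum_(r < (M - #|S|).+1)
     (- (1 - u)) ^+ #|S| * (- (1 - u ^+ #|S|)) ^+ #|A| *
     ('C(M - #|S|, r)%:R * (- (u * (1 - u ^+ #|A|))) ^+ r) *
     (mu p X * ((X i && (A \subset [set j | ~~ X j]%SET))%:R *
       (u ^+ (#|S| + r)) ^+ #|[set j | X j]%SET :\ i|))).
  apply: eq_bigr => X _; have [Xi|Xi] /= := boolP (X i); last first.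
    rewrite big1 => [|C _]; last by rewrite inE (negbTE Xi) mulr0.
    rewrite mulr0 big1// => S _; rewrite big1// => A _; rewrite big1// => r _.
    by rewrite mul0r !mulr0.
  have -> : \sum_(C : 'M[bool]_(N, M)) PPP R L C * (i \in U1 C X)%:R =
            \sum_(C : 'M[bool]_(N, M)) PPP R L C * (~~ sure_one C X i)%:R.
    by apply: eq_bigr => C _; rewrite inE Xi.
  rewrite sum_PPP_not_sure_one// -/u qE mulr_sumr; apply: eq_bigr => S _.
  rewrite mulrA mulr_sumr big_mkcond/=; apply: eq_bigr => A _.
  case: ifPn => _; last by rewrite big1// => r _; rewrite mul0r !mulr0.
  rewrite [X in _ * (_ * X)]expr_1B_sum !mulr_sumr; apply: eq_bigr => r _.
  set m := #|_ :\ _|.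
  have -> : - (u ^+ m.+1 * (1 - u ^+ #|A|)) = - (u * (1 - u ^+ #|A|)) * u ^+ m.
    by rewrite exprS; ring.
  rewrite -[- ((1 - u) * _)]mulNr ![(_ * u ^+ m) ^+ _]exprMn -!exprM mulnDl exprD.
  rewrite [(m * #|S|)%N]mulnC [(m * r)%N]mulnC mul1r.
  move: (u ^+ (#|S| * m)) (u ^+ (r * m)) ((- (1 - u)) ^+ _) (_ ^+ #|A|) (_ ^+ r) => *; ring.
rewrite exchange_big /= /mean_U1 -/u mulr_sumr.
have := @sum_sets_card R 'I_M (fun k => p * ((- (1 - u)) ^+ k *
  \sum_(l < N.-1.+1) 'C(N.-1, l)%:R * (- ((1 - p) * (1 - u ^+ k))) ^+ l *
  \sum_(r < (M - k).+1) 'C(M - k, r)%:R * (- (u * (1 - u ^+ l))) ^+ r *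
    (1 - p + p * u ^+ (k + r)) ^+ (N.-1 - l))).
rewrite card_ord => e.
transitivity (\sum_(k < M.+1) 'C(M, k)%:R * (p * ((- (1 - u)) ^+ k *
  \sum_(l < N.-1.+1) 'C(N.-1, l)%:R * (- ((1 - p) * (1 - u ^+ k))) ^+ l *
  \sum_(r < (M - k).+1) 'C(M - k, r)%:R * (- (u * (1 - u ^+ l))) ^+ r *
    (1 - p + p * u ^+ (k + r)) ^+ (N.-1 - l)))); last first.
  by apply: eq_bigr => k _; rewrite mulrCA !mulrA.
rewrite -e; apply: eq_bigr => S _; set k := #|S|.
rewrite exchange_big /=.
have := @sum_subset_card R 'I_N [set~ i]%SET (fun l => (- ((1 - p) * (1 - u ^+ k))) ^+ l *
  \sum_(r < (M - k).+1) 'C(M - k, r)%:R * (- (u * (1 - u ^+ l))) ^+ r *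
    (1 - p + p * u ^+ (k + r)) ^+ (N.-1 - l)).
rewrite cardsC1 card_ord => e'.
under [X in _ = p * (_ * X)]eq_bigr => l _ do rewrite -mulrA.
rewrite -e' !mulr_sumr [RHS]big_mkcond/=; apply: eq_bigr => A _.
rewrite exchange_big /=.
under eq_bigr => r _ do rewrite -mulr_sumr sum_mu_one_expr.
case: ifP => _; last by rewrite big1// => r _; rewrite mul0r mulr0.
rewrite !mulr_sumr; apply: eq_bigr => r _.
rewrite -[- ((1 - p) * _)]mulrN exprMn mul1r; ring.
Qed.

Lemma sum_PPP_Tcost (R : realType) (N M L : nat) (p : R) :
  \sum_(C : 'M[bool]_(N, M)) @PPP R N M L C * Tcost C p =
  M%:R +
  \sum_(i < N) \sum_(X : {ffun 'I_N -> bool}) mu p X *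
    \sum_(C : 'M[bool]_(N, M)) @PPP R N M L C * (i \in U0 C X)%:R +
  \sum_(i < N) \sum_(X : {ffun 'I_N -> bool}) mu p X *
    \sum_(C : 'M[bool]_(N, M)) @PPP R N M L C * (i \in U1 C X)%:R.
Proof.
have cardE (U : {set 'I_N}) : #|U|%:R = \sum_i (i \in U)%:R :> R.
  by rewrite -natr_sum -sum1_card big_mkcond.
have exch (U : 'M[bool]_(N, M) -> {ffun 'I_N -> bool} -> {set 'I_N}) :
    \sum_(i < N) \sum_(X : {ffun 'I_N -> bool}) mu p X *
      \sum_(C : 'M[bool]_(N, M)) @PPP R N M L C * (i \in U C X)%:R =
    \sum_(C : 'M[bool]_(N, M)) @PPP R N M L C *
      \sum_(X : {ffun 'I_N -> bool}) mu p X * #|U C X|%:R.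
  under [RHS]eq_bigr => C _ do rewrite mulr_sumr.
  rewrite [RHS]exchange_big/= exchange_big/=; apply: eq_bigr => X _.
  rewrite -mulr_sumr exchange_big/= mulr_sumr; apply: eq_bigr => C _.
  by rewrite mulrCA cardE !mulr_sumr.
rewrite !exch -addrA -big_split/= -[X in X + _]mul1r -[X in X * _ + _](sum_PPP R N M L).
rewrite mulr_suml -big_split/=.
apply: eq_bigr => C _; rewrite -mulrDr -mulrDr; congr (_ * (_ + _)).
by rewrite -big_split/=; apply: eq_bigr => X _; rewrite natrD mulrDr.
Qed.

Lemma avg_costE (R : realType) (N : nat) (p : R) :
  avg_cost N p =
  ((Mtil N p)%:R + N%:R * (mean_U0 R N (Mtil N p) (Ltil p) p +
                           mean_U1 R N (Mtil N p) (Ltil p) p)) /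
  (N%:R * p * `|ln p|).
Proof.
rewrite /avg_cost; under eq_bigr => C _ do rewrite mulrA.
rewrite -mulr_suml sum_PPP_Tcost; congr (_ / _).
under eq_bigr => i _ do rewrite mean_U0E.
under [X in _ + X = _]eq_bigr => i _ do rewrite mean_U1E.
by rewrite !sumr_const card_ord -addrA -mulrnDl mulr_natl.
Qed.

Local Open Scope classical_set_scope.
Local Open Scope ring_scope.

(** * Tannery's theorem with an exponential dominating series *)

Lemma cvgn_approx (R : realType) (s : R^nat) :
  (forall e : R, 0 < e -> exists2 v : R^nat, cvgn v &
     \forall n \near \oo, `|s n - v n| <= e) -> cvgn s.
Proof.
move=> h; apply/cauchy_cvgP; apply: cauchy_exP => e e0.
(* Two errors of e/4 add up to strictly less than e, as the open ball requires. *)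
have e20 : 0 < e / 2 / 2 by rewrite !divr_gt0.
have [v cv hv] := h _ e20.
exists (limn v); have /cvgrPdist_le /(_ _ e20) hl := cv.
change (\forall n \near \oo, ball (limn v) e (s n)).
near=> n; rewrite /ball/=.
have h1 : `|s n - v n| <= e / 2 / 2 by near: n.
have h2 : `|limn v - v n| <= e / 2 / 2 by near: n.
move: h1 h2; rewrite !ler_norml => /andP[? ?] /andP[? ?].
by rewrite ltr_norml; apply/andP; split; lra.
Unshelve. all: by end_near. Qed.

Lemma series_exp_coeff_le (R : realType) (B : R) (n : nat) : 0 <= B ->
  series (exp_coeff B) n <= expR B.
Proof.
move=> B0; apply: nondecreasing_cvgn_le; last exact: is_cvg_series_exp_coeff.
apply/nondecreasing_seqP => k.
by rewrite seriesSr lerDl exp_coeff_ge0.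
Qed.

Lemma norm_sum_le_expR (R : realType) (B : R) (n : nat) (v : nat -> R) : 0 <= B ->
  (forall k, `|v k| <= exp_coeff B k) -> `|\sum_(k < n) v k| <= expR B.
Proof.
move=> B0 vB; apply: (le_trans (ler_norm_sum _ _ _)).
apply: (le_trans _ (series_exp_coeff_le R B n B0)).
by rewrite /series /= big_mkord; apply: ler_sum => k _.
Qed.

(** Cut at an m where the tail of the exponential series is at most e. The truncated sum converges
    as a finite sum of convergent sequences, and it is uniformly e-close to the full sum once the
    domination holds. *)
Lemma tannery_exp (R : realType) (u : nat -> nat -> R) (K : nat -> nat) (B : R) :
  0 <= B -> (forall k, cvgn (u ^~ k)) ->
  (\forall n \near \oo, forall k, `|u n k| <= exp_coeff B k) ->
  (forall n k, (K n <= k)%N -> u n k = 0) ->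
  cvgn (fun n => \sum_(k < K n) u n k).
Proof.
move=> B0 cu uB uK; apply: cvgn_approx => e e0.
have /cvgrPdist_le /(_ _ e0) [m _ hm] := is_cvg_series_exp_coeff B.
have {hm} hm : limn (series (exp_coeff B)) - series (exp_coeff B) m <= e.
  by apply: (le_trans (ler_norm _)); apply: hm => /=.
exists (fun n => \sum_(k < m) u n k).
  elim: m {hm} => [|m IH].
    under eq_fun do rewrite big_ord0; exact: is_cvg_cst.
  by under eq_fun do rewrite big_ord_recr /=; exact: is_cvgD.
near=> n.
have un : forall k, `|u n k| <= exp_coeff B k by near: n.
(* [K n] may lie on either side of m. Terms beyond [K n] vanish, so both sums are compared on the
   range up to [P] and differ by the terms from m to [P]. *)
pose P := maxn (K n) m.
have -> : \sum_(k < K n) u n k = \sum_(0 <= k < P) u n k.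
  rewrite (@big_cat_nat _ _ _ (K n)) //= ?leq_maxl// big_mkord.
  rewrite [X in _ + X]big_nat_cond [X in _ + X]big1 ?addr0// => k /andP[/andP[? _] _].
  exact: uK.
rewrite (@big_cat_nat _ _ _ m) //= ?leq_maxr// big_mkord addrAC subrr add0r.
apply: (le_trans (ler_norm_sum _ _ _)).
apply: (@le_trans _ _ (\sum_(m <= k < P) exp_coeff B k)); first exact: ler_sum.
have -> : \sum_(m <= k < P) exp_coeff B k =
    series (exp_coeff B) P - series (exp_coeff B) m.
  by rewrite sub_series_geq// leq_maxr.
apply: (le_trans _ hm); rewrite lerD2r.
exact: series_exp_coeff_le.
Unshelve. all: by end_near. Qed.

(** * Domination and convergence of binomial terms *)

(** The ratio of consecutive terms drives the inductions on k for both the exponential bound and the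
    convergence. *)
Lemma bin_exprS (R : realType) (n k : nat) (x : R) :
  'C(n, k.+1)%:R * x ^+ k.+1 =
  'C(n, k)%:R * x ^+ k * ((n - k)%:R * x) / k.+1%:R.
Proof.
have -> : 'C(n, k.+1)%:R = (n - k)%:R * 'C(n, k)%:R / k.+1%:R :> R.
  by rewrite -natrM -mul_bin_left natrM mulrC mulKf// pnatr_eq0.
rewrite exprS; ring.
Qed.

Lemma norm_bin_expr_le (R : realType) (n k : nat) (x B : R) :
  n%:R * `|x| <= B -> `|'C(n, k)%:R * x ^+ k| <= exp_coeff B k.
Proof.
move=> nxB; have B0 : 0 <= B by apply: le_trans nxB; rewrite mulr_ge0.
elim: k => [|k IH]; first by rewrite bin0 /exp_coeff/= !expr0 mulr1 fact0 divr1 normr1.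
have -> : exp_coeff B k.+1 = exp_coeff B k * B / k.+1%:R.
  rewrite /exp_coeff/= factS natrM invfM exprS; ring.
rewrite bin_exprS 2!normrM normfV normr_nat; apply: ler_wpM2r; first by rewrite invr_ge0.
apply: ler_pM => //; apply: le_trans nxB; rewrite normrM.
by rewrite normr_nat ler_wpM2r// ler_nat leq_subr.
Qed.

Lemma exp_coeffM (R : realType) (B c : R) (k : nat) :
  exp_coeff B k * c ^+ k = exp_coeff (B * c) k.
Proof. by rewrite /exp_coeff/= exprMn mulrAC. Qed.

Lemma cvgn_bounded (R : realType) (z : R^nat) : cvgn z ->
  exists2 B : R, 0 <= B & \forall n \near \oo, `|z n| <= B.
Proof.
move=> /cvgrPdist_le/(_ 1 ltr01) h; exists (`|limn z| + 1); first by rewrite addr_ge0.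
apply: filterS h => n h; rewrite -[z n](subrK (limn z)) addrC.
by apply: (le_trans (ler_normD _ _)); rewrite lerD2l distrC.
Qed.

(** Truncated subtraction removes [minn (m n) k], which costs at most k |x n|, and this tends to
    0. *)
Lemma cvgn_subn (R : realType) (m : nat -> nat) (x : R^nat) (k : nat) :
  cvgn (fun n => (m n)%:R * x n) -> x @ \oo --> (0 : R) ->
  cvgn (fun n => (m n - k)%:R * x n).
Proof.
move=> cmx x0.
have E : (fun n => (m n - k)%:R * x n) =
    (fun n => (m n)%:R * x n) \- (fun n => (minn (m n) k)%:R * x n).
  apply/funext => n /=; rewrite -mulrBl; congr (_ * _).
  by rewrite -natrB ?geq_minl//; congr (_%:R); lia.
rewrite E; apply: is_cvgB => //; apply: (@cvgP _ _ (0 : R)).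
apply/norm_cvg0P.
apply: (@squeeze_cvgr _ _ _ _ (fun=> 0) (fun n => k%:R * `|x n|)).
- near=> n; rewrite normr_ge0 /= normrM normr_nat ler_wpM2r// ler_nat geq_minr//.
- exact: cvg_cst.
- rewrite -[X in _ --> X](mulr0 k%:R); apply: cvgM; first exact: cvg_cst.
  exact/norm_cvg0P.
Unshelve. all: by end_near. Qed.

Lemma cvgn_bin_expr (R : realType) (m : nat -> nat) (x : R^nat) (k : nat) :
  cvgn (fun n => (m n)%:R * x n) -> x @ \oo --> (0 : R) ->
  cvgn (fun n => 'C(m n, k)%:R * x n ^+ k).
Proof.
move=> cmx x0; elim: k => [|k IH].
  by under eq_fun do rewrite bin0 mulr1; exact: is_cvg_cst.
under eq_fun do rewrite bin_exprS.
apply: is_cvgM; last exact: is_cvg_cst.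
by apply: is_cvgM => //; exact: cvgn_subn.
Qed.

(** The power is expanded by the binomial theorem and handled by Tannery's theorem, bounded values
    of [m n * x n] giving the dominating series. *)
Lemma cvgn_expr_1B (R : realType) (m : nat -> nat) (x : R^nat) :
  cvgn (fun n => (m n)%:R * x n) -> x @ \oo --> (0 : R) ->
  cvgn (fun n => (1 - x n) ^+ m n).
Proof.
move=> cmx x0; under eq_fun do rewrite expr_1B_sum.
have [B B0 hB] := cvgn_bounded _ _ cmx.
apply: (@tannery_exp _ (fun n k => 'C(m n, k)%:R * (- x n) ^+ k) (fun n => (m n).+1) B) => //.
- move=> k; apply: (@cvgn_bin_expr _ m (fun n => - x n)).
    by under eq_fun do rewrite mulrN; exact: is_cvgN.
  by rewrite -oppr0; exact: cvgN.
- apply: filterS hB => n h k; apply: norm_bin_expr_le.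
  by rewrite normrN; move: h; rewrite normrM normr_nat.
- by move=> n k mk; rewrite bin_small// mul0r.
Qed.

Lemma cvgn_1B_expr0 (R : realType) (q : R^nat) (k : nat) :
  q @ \oo --> (0 : R) -> (fun n => 1 - (1 - q n) ^+ k) @ \oo --> (0 : R).
Proof.
move=> q0; elim: k => [|k IH].
  by under eq_fun do rewrite expr0 subrr; exact: cvg_cst.
have -> : (fun n => 1 - (1 - q n) ^+ k.+1) =
  (fun n => (1 - (1 - q n) ^+ k) + q n * (1 - (1 - (1 - q n) ^+ k))).
  by apply/funext => n; rewrite exprS; ring.
have -> : 0 = 0 + 0 * (1 - 0) :> R by rewrite mul0r addr0.
by apply: cvgD => //; apply: cvgM => //; apply: cvgB => //; exact: cvg_cst.
Qed.

Lemma cvgn_M1B_expr (R : realType) (s q : R^nat) (k : nat) :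
  q @ \oo --> (0 : R) -> cvgn (fun n => s n * q n) ->
  cvgn (fun n => s n * (1 - (1 - q n) ^+ k)).
Proof.
move=> q0 sq; elim: k => [|k IH].
  by under eq_fun do rewrite expr0 subrr mulr0; exact: is_cvg_cst.
have -> : (fun n => s n * (1 - (1 - q n) ^+ k.+1)) =
  (fun n => s n * (1 - (1 - q n) ^+ k) + s n * q n * (1 - (1 - (1 - q n) ^+ k))).
  by apply/funext => n; rewrite exprS; ring.
apply: is_cvgD => //; apply: is_cvgM => //; apply: is_cvgB; first exact: is_cvg_cst.
by apply: cvgP; exact: cvgn_1B_expr0.
Qed.

Lemma onem_expr_itv (R : realType) (q : R) (k : nat) : 0 <= q <= 1 ->
  0 <= 1 - (1 - q) ^+ k <= k%:R * q.
Proof.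
move=> /andP[q0 q1].
have u01 : 0 <= 1 - q <= 1 by lra.
have uk j : 0 <= (1 - q) ^+ j <= 1 by rewrite exprn_ge0 ?exprn_ile1//; lra.
apply/andP; split; first by have := uk k; lra.
elim: k => [|k IH]; first by rewrite expr0 subrr mul0r.
have := uk k; rewrite exprS -natr1 => ukk.
have : q * (1 - q) ^+ k <= q by rewrite ler_piMr//; lra.
lra.
Qed.

Lemma expr_itv01 (R : realType) (x : R) (k : nat) : 0 <= x <= 1 -> 0 <= x ^+ k <= 1.
Proof. by move=> /andP[x0 x1]; rewrite exprn_ge0 ?exprn_ile1. Qed.

Lemma conv_expr_itv01 (R : realType) (p u : R) (k : nat) :
  0 <= p <= 1 -> 0 <= u <= 1 -> 0 <= 1 - p + p * u ^+ k <= 1.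
Proof.
move=> /andP[p0 p1] u01; have /andP[uk0 uk1] := expr_itv01 _ _ k u01.
have := mulr_ge0 p0 uk0; have : p * u ^+ k <= p by rewrite ler_piMr.
lra.
Qed.

(** * Convergence of both means as N grows, at fixed p *)

Section MeanLimit.
Variables (R : realType) (p : R) (L : nat) (M : nat -> nat).
Hypothesis p01 : 0 <= p <= 1.
Let q n : R := L%:R / (M n)%:R.
Hypothesis q0 : q @ \oo --> (0 : R).
Hypothesis Mq : cvgn (fun n => (M n)%:R * q n).
Hypothesis nq : cvgn (fun n => n%:R * q n).

(** For small n the number of tests may be below [L], so [q n] is a probability only eventually. *)
Lemma near_q01 : \forall n \near \oo, 0 <= q n <= 1.
Proof.
have /cvgrPdist_le /(_ 1 ltr01) := q0; apply: filterS => n.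
rewrite sub0r normrN => h; rewrite /q divr_ge0//=.
exact: le_trans (ler_norm _) h.
Qed.

Lemma cvgn_predn_q : cvgn (fun n => n.-1%:R * q n).
Proof. by under eq_fun do rewrite -subn1; exact: cvgn_subn. Qed.

Lemma cvgn_conv_expr (k l : nat) :
  cvgn (fun n => (1 - p + p * (1 - q n) ^+ k) ^+ (n.-1 - l)).
Proof.
have E n : 1 - p + p * (1 - q n) ^+ k = 1 - p * (1 - (1 - q n) ^+ k) by ring.
under eq_fun do rewrite E.
apply: (@cvgn_expr_1B R (fun n => (n.-1 - l)%N) (fun n => p * (1 - (1 - q n) ^+ k))).
  have -> : (fun n => (n.-1 - l)%:R * (p * (1 - (1 - q n) ^+ k))) =
            (fun n => p * ((n.-1 - l)%:R * (1 - (1 - q n) ^+ k))).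
    by apply/funext => n; rewrite mulrCA.
  apply: is_cvgM; first exact: is_cvg_cst.
  apply: cvgn_M1B_expr => //; apply: cvgn_subn => //; exact: cvgn_predn_q.
rewrite -[X in _ --> X](mulr0 p); apply: cvgM; first exact: cvg_cst.
exact: cvgn_1B_expr0.
Qed.

Lemma cvgn_mean_U0 : cvgn (fun n => mean_U0 R n (M n) L p).
Proof.
have [B B0 hB] := cvgn_bounded _ _ Mq.
rewrite /mean_U0.
apply: (@tannery_exp _ (fun n r => 'C(M n, r)%:R * (- q n) ^+ r *
    ((1 - p) * (1 - p + p * (1 - q n) ^+ r) ^+ n.-1)) (fun n => (M n).+1) B) => //.
- move=> r; apply: is_cvgM.
    apply: (@cvgn_bin_expr _ M (fun n => - q n)).
      by under eq_fun do rewrite mulrN; exact: is_cvgN.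
    by rewrite -oppr0; exact: cvgN.
  apply: is_cvgM; first exact: is_cvg_cst.
  by under eq_fun do rewrite -[_.-1]subn0; exact: cvgn_conv_expr.
- near=> n => r; rewrite normrM.
  have q01 : 0 <= q n <= 1 by near: n; exact: near_q01.
  have u01 : 0 <= 1 - q n <= 1 by lra.
  have hn : `|(M n)%:R * q n| <= B by near: n.
  have : `|'C(M n, r)%:R * (- q n) ^+ r| <= exp_coeff B r.
    by apply: norm_bin_expr_le; move: hn; rewrite normrM normr_nat normrN.
  apply: le_trans; rewrite ler_piMr//.
  have /andP[c0 c1] := expr_itv01 _ _ n.-1 (conv_expr_itv01 _ _ _ r p01 u01).
  have p'0 : 0 <= 1 - p <= 1 by have := p01; lra.
  by have /andP[? ?] := p'0; rewrite ger0_norm ?mulr_ge0// mulr_ile1.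
- by move=> n k Mk; rewrite bin_small// !mul0r.
Unshelve. all: by end_near. Qed.

(** The two inner sums of [mean_U1], treated from the inside out. Each is bounded by a geometric
    expression in the index of the next outer sum, which merely rescales the exponential series
    dominating that sum. *)
Let inner n k l := \sum_(r < (M n - k).+1)
  'C(M n - k, r)%:R * (- ((1 - q n) * (1 - (1 - q n) ^+ l))) ^+ r *
    (1 - p + p * (1 - q n) ^+ (k + r)) ^+ (n.-1 - l).

Let middle n k := \sum_(l < n.-1.+1)
  'C(n.-1, l)%:R * (- ((1 - p) * (1 - (1 - q n) ^+ k))) ^+ l * inner n k l.

Lemma inner_term_le (B : R) n k l r : 0 <= q n <= 1 -> (M n)%:R * q n <= B ->
  `|'C(M n - k, r)%:R * (- ((1 - q n) * (1 - (1 - q n) ^+ l))) ^+ r *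
    (1 - p + p * (1 - q n) ^+ (k + r)) ^+ (n.-1 - l)| <= exp_coeff (B * l%:R) r.
Proof.
move=> q01 MB; have u01 : 0 <= 1 - q n <= 1 by lra.
rewrite normrM.
have /andP[c0 c1] := expr_itv01 _ _ (n.-1 - l) (conv_expr_itv01 _ _ _ (k + r) p01 u01).
rewrite (ger0_norm c0); apply: (le_trans (ler_piMr _ c1)) => //.
apply: norm_bin_expr_le; rewrite normrN.
have /andP[b0 b1] := onem_expr_itv _ _ l q01.
have /andP[u0 u1] := u01.
rewrite ger0_norm ?mulr_ge0//.
apply: (@le_trans _ _ ((M n)%:R * (l%:R * q n))); last first.
  by rewrite mulrCA mulrC ler_wpM2r.
apply: ler_pM => //; first by rewrite mulr_ge0.
  by rewrite ler_nat leq_subr.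
by apply: (le_trans _ b1); rewrite ler_piMl.
Qed.

Lemma inner_le (B : R) n k l : 0 <= B -> 0 <= q n <= 1 -> (M n)%:R * q n <= B ->
  `|inner n k l| <= expR B ^+ l.
Proof.
move=> B0 q01 MB; rewrite -expRM_natr.
apply: (norm_sum_le_expR R _ _ (fun r =>
  'C(M n - k, r)%:R * (- ((1 - q n) * (1 - (1 - q n) ^+ l))) ^+ r *
    (1 - p + p * (1 - q n) ^+ (k + r)) ^+ (n.-1 - l))); first by rewrite mulr_ge0.
by move=> r; exact: inner_term_le.
Qed.

Lemma cvgn_inner k l : cvgn (fun n => inner n k l).
Proof.
have [B B0 hB] := cvgn_bounded _ _ Mq.
rewrite /inner.
apply: (@tannery_exp _ (fun n r =>
  'C(M n - k, r)%:R * (- ((1 - q n) * (1 - (1 - q n) ^+ l))) ^+ r *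
    (1 - p + p * (1 - q n) ^+ (k + r)) ^+ (n.-1 - l)) _ (B * l%:R)).
- by rewrite mulr_ge0.
- move=> r; apply: is_cvgM; last exact: cvgn_conv_expr.
  apply: (@cvgn_bin_expr _ (fun n => (M n - k)%N)
    (fun n => - ((1 - q n) * (1 - (1 - q n) ^+ l)))); last first.
    rewrite -[X in _ --> X](_ : - ((1 - 0) * 0) = 0); last by rewrite mulr0 oppr0.
    apply: cvgN; apply: cvgM; last exact: cvgn_1B_expr0.
    by apply: cvgB => //; exact: cvg_cst.
  have -> : (fun n => (M n - k)%:R * - ((1 - q n) * (1 - (1 - q n) ^+ l))) =
            (fun n => - ((1 - q n) * ((M n - k)%:R * (1 - (1 - q n) ^+ l)))).
    by apply/funext => n; rewrite mulrN mulrCA.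
  apply: is_cvgN; apply: is_cvgM.
    by apply: is_cvgB; [exact: is_cvg_cst | exact: cvgP q0].
  by apply: cvgn_M1B_expr => //; exact: cvgn_subn.
- near=> n => r; apply: inner_term_le; first by near: n; exact: near_q01.
  by apply: le_trans (ler_norm _) _; near: n.
- by move=> n r Mr; rewrite bin_small// !mul0r.
Unshelve. all: by end_near. Qed.

Lemma middle_term_le (B1 B2 : R) n k l : 0 <= B1 -> 0 <= q n <= 1 ->
  (M n)%:R * q n <= B1 -> n.-1%:R * q n <= B2 ->
  `|'C(n.-1, l)%:R * (- ((1 - p) * (1 - (1 - q n) ^+ k))) ^+ l * inner n k l| <=
  exp_coeff (B2 * expR B1 * k%:R) l.
Proof.
move=> B10 q01 MB nB; rewrite [B2 * _ * _]mulrAC -exp_coeffM normrM.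
apply: ler_pM => //; last exact: inner_le.
apply: norm_bin_expr_le; rewrite normrN.
have /andP[b0 b1] := onem_expr_itv _ _ k q01.
have p'0 : 0 <= 1 - p by have := p01; lra.
rewrite ger0_norm ?mulr_ge0//.
apply: (@le_trans _ _ (n.-1%:R * (k%:R * q n))); last first.
  by rewrite mulrCA mulrC ler_wpM2r.
rewrite ler_wpM2l//; apply: (le_trans _ b1); rewrite ler_piMl//; have := p01; lra.
Qed.

Lemma middle_le (B1 B2 : R) n k : 0 <= B1 -> 0 <= B2 -> 0 <= q n <= 1 ->
  (M n)%:R * q n <= B1 -> n.-1%:R * q n <= B2 ->
  `|middle n k| <= expR (B2 * expR B1) ^+ k.
Proof.
move=> B10 B20 q01 MB nB; rewrite -expRM_natr.
apply: (norm_sum_le_expR R _ _ (fun l =>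
  'C(n.-1, l)%:R * (- ((1 - p) * (1 - (1 - q n) ^+ k))) ^+ l * inner n k l)).
  by rewrite !mulr_ge0// expR_ge0.
by move=> l; exact: middle_term_le.
Qed.

Lemma cvgn_middle k : cvgn (fun n => middle n k).
Proof.
have [B1 B10 hB1] := cvgn_bounded _ _ Mq.
have [B2 B20 hB2] := cvgn_bounded _ _ cvgn_predn_q.
rewrite /middle.
apply: (@tannery_exp _ (fun n l =>
  'C(n.-1, l)%:R * (- ((1 - p) * (1 - (1 - q n) ^+ k))) ^+ l * inner n k l)
  _ (B2 * expR B1 * k%:R)).
- by rewrite !mulr_ge0// expR_ge0.
- move=> l; apply: is_cvgM; last exact: cvgn_inner.
  apply: (@cvgn_bin_expr _ predn (fun n => - ((1 - p) * (1 - (1 - q n) ^+ k)))); last first.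
    rewrite -[X in _ --> X](_ : - ((1 - p) * 0) = 0); last by rewrite mulr0 oppr0.
    by apply: cvgN; apply: cvgM; [exact: cvg_cst | exact: cvgn_1B_expr0].
  have -> : (fun n => n.-1%:R * - ((1 - p) * (1 - (1 - q n) ^+ k))) =
            (fun n => - ((1 - p) * (n.-1%:R * (1 - (1 - q n) ^+ k)))).
    by apply/funext => n; rewrite mulrN mulrCA.
  apply: is_cvgN; apply: is_cvgM; first exact: is_cvg_cst.
  by apply: cvgn_M1B_expr => //; exact: cvgn_predn_q.
- near=> n => l; apply: middle_term_le => //; first by near: n; exact: near_q01.
    by apply: le_trans (ler_norm _) _; near: n.
  by apply: le_trans (ler_norm _) _; near: n.
- by move=> n l nl; rewrite bin_small// !mul0r.
Unshelve. all: by end_near. Qed.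

Lemma cvgn_mean_U1 : cvgn (fun n => mean_U1 R n (M n) L p).
Proof.
have [B1 B10 hB1] := cvgn_bounded _ _ Mq.
have [B2 B20 hB2] := cvgn_bounded _ _ cvgn_predn_q.
rewrite /mean_U1; apply: is_cvgM; first exact: is_cvg_cst.
have E n : (1 - (1 - q n)) = q n by ring.
have -> : (fun n => \sum_(k < (M n).+1) 'C(M n, k)%:R * (- (1 - (1 - q n))) ^+ k * middle n k) =
   (fun n => \sum_(k < (M n).+1) 'C(M n, k)%:R * (- q n) ^+ k * middle n k).
  by apply/funext => n; rewrite E.
apply: (@tannery_exp _ (fun n k => 'C(M n, k)%:R * (- q n) ^+ k * middle n k)
  _ (B1 * expR (B2 * expR B1))).
- by rewrite mulr_ge0// expR_ge0.
- move=> k; apply: is_cvgM; last exact: cvgn_middle.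
  apply: (@cvgn_bin_expr _ M (fun n => - q n)).
    by under eq_fun do rewrite mulrN; exact: is_cvgN.
  by rewrite -oppr0; exact: cvgN.
- near=> n => k; rewrite -exp_coeffM normrM.
  have q01 : 0 <= q n <= 1 by near: n; exact: near_q01.
  have h1 : `|(M n)%:R * q n| <= B1 by near: n.
  have h2 : `|n.-1%:R * q n| <= B2 by near: n.
  apply: ler_pM => //.
    by apply: norm_bin_expr_le; move: h1; rewrite normrM normr_nat normrN.
  by apply: middle_le => //; exact: le_trans (ler_norm _) _.
- by move=> n k Mk; rewrite bin_small// !mul0r.
Unshelve. all: by end_near. Qed.

End MeanLimit.

(** * Uniform bounds on the means and on the average cost *)

Lemma mu_ge0 (R : realType) (N : nat) (p : R) (X : {ffun 'I_N -> bool}) :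
  0 <= p <= 1 -> 0 <= mu p X.
Proof.
move=> /andP[p0 p1]; apply: prodr_ge0 => i _; case: ifP => // _.
by rewrite subr_ge0.
Qed.

Lemma PPP_ge0 (R : realType) (N M L : nat) (C : 'M[bool]_(N, M)) :
  (L <= M)%N -> 0 <= PPP R L C.
Proof.
move=> LM; have q0 : 0 <= L%:R / M%:R :> R by rewrite divr_ge0.
have q1 : L%:R / M%:R <= 1 :> R.
  (* For M = 0 the quotient is 0, the inverse of 0 being 0. *)
  case: M LM {C q0} => [|M] LM; first by rewrite invr0 mulr0 ler01.
  by rewrite ler_pdivrMr// mul1r ler_nat.
apply: prodr_ge0 => a _; apply: prodr_ge0 => i _; case: ifP => // _.
by rewrite subr_ge0.
Qed.

(** The closed formula alternates in sign, so positivity is read off the expectation of [mean_U0E],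
    taken at a variable that exists because N > 0. *)
Lemma mean_U0_ge0 (R : realType) (N M L : nat) (p : R) :
  (0 < N)%N -> (L <= M)%N -> 0 <= p <= 1 -> 0 <= mean_U0 R N M L p.
Proof.
move=> N0 LM p01; rewrite -(@mean_U0E R N M L p (Ordinal N0)).
apply: sumr_ge0 => X _; rewrite mulr_ge0 ?mu_ge0//; apply: sumr_ge0 => C _.
by rewrite mulr_ge0 ?PPP_ge0.
Qed.

Lemma mean_U1_itv (R : realType) (N M L : nat) (p : R) :
  (0 < N)%N -> (L <= M)%N -> 0 <= p <= 1 -> 0 <= mean_U1 R N M L p <= p.
Proof.
move=> N0 LM p01; rewrite -(@mean_U1E R N M L p (Ordinal N0)); apply/andP; split.
  apply: sumr_ge0 => X _; rewrite mulr_ge0 ?mu_ge0//; apply: sumr_ge0 => C _.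
  by rewrite mulr_ge0 ?PPP_ge0.
(* An element of [U1] is a one, and a variable is a one with probability p: this is
   [sum_mu_hit_avoid] with an empty set to avoid. *)
have i0 : Ordinal N0 \notin (finset.set0 : {set 'I_N}) by rewrite inE.
have := @sum_mu_hit_avoid R N p (Ordinal N0) finset.set0 i0.
rewrite finset.cards0 expr0 mulr1 => {2}<-.
apply: ler_sum => X _; rewrite ler_wpM2l ?mu_ge0//.
have -> : [forall j in (finset.set0 : {set 'I_N}), ~~ X j].
  by apply/forallP => j; rewrite inE.
rewrite andbT -[leRHS]mul1r -[X in _ <= X * _](sum_PPP R N M L) mulr_suml; apply: ler_sum => C _.
rewrite ler_wpM2l ?PPP_ge0// ler_nat inE.
by case: (X _) => /=; rewrite ?leq_b1.
Qed.

(** With y = q / (1 - q), 1 - q = 1 / (1 + y) is at least exp(-y). So the power is at least exp(-1)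
    exp(1 - y m), and exp is bounded below by its tangent at 0, that is at y m = 1. *)
Lemma expr_1B_ge_tangent (R : realType) (q : R) (m : nat) : 0 <= q < 1 ->
  expR (- 1) * (2 - q / (1 - q) * m%:R) <= (1 - q) ^+ m.
Proof.
move=> /andP[q0 q1]; set y := q / (1 - q).
have u0 : 0 < 1 - q by rewrite subr_gt0.
have h : expR (- y) <= 1 - q.
  rewrite expRN -[leRHS]invrK lef_pV2 ?posrE ?invr_gt0 ?expR_gt0//.
  have -> : (1 - q)^-1 = 1 + y by rewrite /y; field; rewrite gt_eqF.
  exact: expR_ge1Dx.
apply: (@le_trans _ _ (expR (- y) ^+ m)); last first.
  by apply: lerXn2r; rewrite ?nnegrE ?expR_ge0 ?(ltW u0).
rewrite -expRM_natr.
have -> : - y * m%:R = - 1 + (1 - y * m%:R) by ring.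
rewrite expRD ler_wpM2l ?expR_ge0//; apply: le_trans (expR_ge1Dx _).
lra.
Qed.

(** The failure probability is at most exp(-L (1 - q)^m), and the tangent bound makes the exponent
    affine in m. The exponential moment of m is (1 - p + p t)^N, at most exp(N p (t - 1)). *)
Lemma mean_U0_le (R : realType) (N M L : nat) (p : R) :
  (0 < N)%N -> (L < M)%N -> 0 <= p <= 1 ->
  forall q c : R, q = L%:R / M%:R -> c = L%:R * expR (- 1) ->
  mean_U0 R N M L p <=
  expR (- (2 * c) + N%:R * p * (expR (c * (q / (1 - q))) - 1)).
Proof.
move=> N0 LM p01 q c qE cE.
have M0 : 0 < M%:R :> R by rewrite ltr0n (leq_ltn_trans _ LM).
have q01 : 0 <= q < 1 by rewrite qE divr_ge0//= ltr_pdivrMr// mul1r ltr_nat.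
set y := q / (1 - q); set t := expR (c * y).
rewrite -(@mean_U0E R N M L p (Ordinal N0)) sum_mu_PPP_U0 -qE.
apply: (@le_trans _ _ (\sum_(X : {ffun 'I_N -> bool}) mu p X *
   (expR (- (2 * c)) * t ^+ #|[set j | X j]%SET|))).
  apply: ler_sum => X _; rewrite ler_wpM2l ?mu_ge0//; set m := #|_|.
  set w := (1 - q) ^+ m.
  have w01 : 0 <= w <= 1 by apply: expr_itv01; lra.
  have qw : 0 <= q * w <= 1.
    have /andP[w0 w1] := w01; have /andP[qq0 qq1] := q01.
    by rewrite mulr_ge0// mulr_ile1// ltW.
  have z0 : 0 <= 1 - q * w by lra.
  apply: (@le_trans _ _ ((1 - q * w) ^+ M)).
    by rewrite ler_piMl ?exprn_ge0//; case: (X _).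
  apply: (@le_trans _ _ (expR (- (q * w)) ^+ M)).
    by apply: lerXn2r; rewrite ?nnegrE ?expR_ge0// expR_ge1Dx.
  rewrite -expRM_natr /t -expRM_natr -expRD ler_expR.
  have -> : - (q * w) * M%:R = - (L%:R * w).
    by rewrite qE; field; rewrite gt_eqF.
  have := @expr_1B_ge_tangent R q m q01; rewrite -/w -/y => hw.
  have := ler_wpM2l (ler0n R L) hw; rewrite cE; lra.
have -> : \sum_(X : {ffun 'I_N -> bool}) mu p X *
    (expR (- (2 * c)) * t ^+ #|[set j | X j]%SET|) =
    expR (- (2 * c)) * (1 - p + p * t) ^+ N.
  by rewrite -sum_mu_expr mulr_sumr; apply: eq_bigr => X _; rewrite mulrCA.
rewrite expRD ler_wpM2l ?expR_ge0// -[N%:R * p * _]mulrA expRM_natl.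
have t0 := expR_ge0 (c * y).
have pt0 : 0 <= p * t by apply: mulr_ge0 => //; lra.
apply: lerXn2r; rewrite ?nnegrE ?expR_ge0//; first lra.
by apply: le_trans (expR_ge1Dx _); rewrite le_eqVlt; apply/orP; left; apply/eqP; ring.
Qed.

(** Here N p q is about 1 and c = L / e is about |ln p|. The second term of the exponent in
    [mean_U0_le] is at most c + 1, so the exponent is at most 1 - c, hence at most 2 + ln p because
    -ln p is at most c + 1. *)
Lemma mean_U0_le_M (R : realType) (N : nat) (p : R) :
  (0 < N)%N -> 0 < p < 1 -> (1 <= Ltil p)%N -> (10 * Ltil p ^ 3 <= Mtil N p)%N ->
  mean_U0 R N (Mtil N p) (Ltil p) p <= expR 2 * p.
Proof.
set L := Ltil p; set M := Mtil N p => N0 p01 L1 LM.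
have /andP[p0 p1] := p01.
have ln0 : ln p < 0 by exact: ln_lt0.
have N0' : 0 < N%:R :> R by rewrite ltr0n.
have e0 : 0 < expR 1 :> R by exact: expR_gt0.
have l0 : 0 < `|ln p| by rewrite normr_gt0 lt_eqF.
have /andP[L_le L_gt] : L%:R <= expR 1 * `|ln p| < L.+1%:R.
  by apply: truncn_itv; rewrite mulr_ge0// ltW.
have /andP[M_le M_gt] : M%:R <= expR 1 * N%:R * p * `|ln p| < M.+1%:R.
  by apply: truncn_itv; rewrite !mulr_ge0// ltW.
have LltM : (L < M)%N.
  by apply: leq_trans LM; rewrite !expnS expn0; nia.
have p01' : 0 <= p <= 1 by rewrite !ltW.
have -> : expR 2 * p = expR (2 + ln p) by rewrite [RHS]expRD lnK// posrE.
set q : R := L%:R / M%:R; set c : R := L%:R * expR (- 1).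
apply: (le_trans (@mean_U0_le R N M L p N0 LltM p01' q c erefl erefl)).
rewrite ler_expR.
have ec : expR 1 * c = L%:R by rewrite /c mulrCA -expRD subrr expR0 mulr1.
have e1 : 2 <= expR 1 :> R by apply: le_trans (expR_ge1Dx _); lra.
have L1' : 1 <= L%:R :> R by rewrite ler1n.
have LM' : 10 * L%:R ^+ 3 <= M%:R :> R by rewrite -natrX -natrM ler_nat.
have M0 : 0 < M%:R :> R by rewrite ltr0n (leq_ltn_trans _ LltM).
have c0 : 0 < c by rewrite mulr_gt0 ?expR_gt0//; lra.
have cL : c <= L%:R by rewrite -ec ler_pMl//; lra.
have qM : q * M%:R = L%:R by rewrite /q divfK// gt_eqF.
have q0 : 0 < q by rewrite divr_gt0//; lra.
(* This is c (1 + 1/M) <= (c + 1) (1 - q (1 + c)) rearranged. Multiplied by M, the left side is L (1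
   + c)^2 + c, at most 5 L^3 since c <= L and 1 <= L. *)
have small : q * (1 + c) + c * (q * (1 + c) + M%:R^-1) <= 1.
  rewrite -(ler_pM2r M0) mul1r.
  have -> : (q * (1 + c) + c * (q * (1 + c) + M%:R^-1)) * M%:R =
     (q * M%:R) * (1 + c) * (1 + c) + c by field; rewrite gt_eqF.
  rewrite qM; apply: le_trans LM'.
  have : L%:R * (1 + c) * (1 + c) <= L%:R * (L%:R + L%:R) * (L%:R + L%:R).
    apply: ler_pM; [| | apply: ler_pM |]; rewrite ?mulr_ge0//; lra.
  have : L%:R <= L%:R ^+ 3 :> R by rewrite exprS ler_pMr ?exprn_ege1//; lra.
  have -> : L%:R * (L%:R + L%:R) * (L%:R + L%:R) = 4 * L%:R ^+ 3 :> R by ring.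
  have : 0 <= L%:R ^+ 3 :> R by rewrite exprn_ge0.
  lra.
set D := 1 - q * (1 + c).
have D0 : 0 < D.
  have : 0 < c * (q * (1 + c) + M%:R^-1).
    by rewrite mulr_gt0// addr_gt0 ?invr_gt0// mulr_gt0//; lra.
  rewrite /D; lra.
have u0 : 0 < 1 - q.
  have : 0 < q * c by rewrite mulr_gt0.
  rewrite /D in D0; lra.
set y := c * (q / (1 - q)).
have y1E : 1 - y = D / (1 - q) by rewrite /y /D; field; rewrite gt_eqF.
have y1 : 0 < 1 - y by rewrite y1E divr_gt0.
(* From exp(-y) >= 1 - y, inverted. *)
have ey : expR y - 1 <= c * q / D.
  have -> : c * q / D = (1 - y)^-1 - 1.
    rewrite y1E /D; field; rewrite /D in D0; rewrite !gt_eqF//; lra.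
  rewrite lerD2r -[leLHS]invrK lef_pV2 ?posrE ?invr_gt0 ?expR_gt0//.
  by rewrite -expRN; exact: expR_ge1Dx.
(* L is at most e |ln p|, so N p L is below M + 1; the term 1/M is the price of the integer part in
   M. *)
have Npq : N%:R * p * q <= 1 + M%:R^-1.
  rewrite -(ler_pM2r M0) -[_ * q * _]mulrA qM mulrDl mulVf ?gt_eqF// mul1r natr1.
  apply: le_trans (ltW M_gt).
  have -> : expR 1 * N%:R * p * `|ln p| = N%:R * p * (expR 1 * `|ln p|) by ring.
  by rewrite ler_wpM2l// mulr_ge0// ltW.
have : N%:R * p * (expR y - 1) <= c + 1.
  apply: (@le_trans _ _ (N%:R * p * (c * q / D))).
    by rewrite ler_wpM2l// mulr_ge0// ltW.
  have -> : N%:R * p * (c * q / D) = c * (N%:R * p * q) / D by ring.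
  rewrite ler_pdivrMr//.
  apply: (@le_trans _ _ (c * (1 + M%:R^-1))); first by rewrite ler_wpM2l// ltW.
  rewrite /D; move: small; lra.
have : - ln p <= c + 1.
  rewrite -(ler_pM2l e0) mulrDr ec mulr1.
  move: L_gt; rewrite ltr0_norm// -natr1; lra.
lra.
Qed.

(** Below, only the integer part in M is lost. Above, N times the sum of the two means is at most
    (e^2 + 1) N p. *)
Lemma avg_cost_itv (R : realType) (N : nat) (p : R) :
  (0 < N)%N -> 0 < p < 1 -> (1 <= Ltil p)%N -> (10 * Ltil p ^ 3 <= Mtil N p)%N ->
  expR 1 - (N%:R * p * `|ln p|)^-1 <= avg_cost N p <=
  expR 1 + (expR 2 + 1) / `|ln p|.
Proof.
move=> N0 p01 L1 LM.
have /andP[p0 p1] := p01.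
have p01' : 0 <= p <= 1 by rewrite !ltW.
have ln0 : ln p < 0 by exact: ln_lt0.
have N0' : 0 < N%:R :> R by rewrite ltr0n.
have e0 : 0 < expR 1 :> R by exact: expR_gt0.
have l0 : 0 < `|ln p| by rewrite normr_gt0 lt_eqF.
have LleM : (Ltil p <= Mtil N p)%N.
  by apply: leq_trans LM; rewrite !expnS expn0; nia.
have := @mean_U0_le_M R N p N0 p01 L1 LM.
have := @mean_U0_ge0 R N _ _ p N0 LleM p01'.
have := @mean_U1_itv R N _ _ p N0 LleM p01'.
rewrite avg_costE.
have /andP[M_le M_gt] : (Mtil N p)%:R <= expR 1 * N%:R * p * `|ln p| < (Mtil N p).+1%:R.
  by apply: truncn_itv; rewrite !mulr_ge0// ltW.
move: M_le M_gt; rewrite -natr1; move: (Mtil N p)%:R (mean_U0 _ _ _ _ _) (mean_U1 _ _ _ _ _).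
move=> M U V Mle Mgt /andP[V0 V1] U0 U1.
set D := N%:R * p * `|ln p|.
have D0 : 0 < D by rewrite !mulr_gt0.
have -> : expR 1 - D^-1 = (expR 1 * D - 1) / D by field; rewrite gt_eqF.
have -> : expR 1 + (expR 2 + 1) / `|ln p| = (expR 1 * D + N%:R * (expR 2 * p + p)) / D.
  by rewrite /D; field; rewrite !gt_eqF.
rewrite !ler_pM2r ?invr_gt0//.
have eD : expR 1 * N%:R * p * `|ln p| = expR 1 * D by rewrite /D; ring.
rewrite eD in Mle Mgt; apply/andP; split.
  have : 0 <= N%:R * (U + V) by rewrite mulr_ge0 ?addr_ge0// ltW.
  lra.
by apply: lerD => //; rewrite ler_wpM2l// lerD.
Qed.

(** * The limit in N at fixed p, for beta = 0 *)

Lemma cvgn_near_eq (R : realType) (f g : R^nat) :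
  (\forall n \near \oo, f n = g n) -> cvgn g -> cvgn f.
Proof.
move=> fg cg; apply: cvgn_approx => e e0; exists g => //.
by apply: filterS fg => n ->; rewrite subrr normr0 ltW.
Qed.

Lemma cvgn_natV (R : realType) : (fun n => n%:R^-1 : R) @ \oo --> (0 : R).
Proof.
apply/gtr0_cvgV0; last exact: cvgr_idn.
by near=> n; rewrite ltr0n; near: n; exact: nbhs_infty_gt.
Unshelve. all: by end_near. Qed.

Lemma Mtil_itv (R : realType) (N : nat) (p : R) : 0 <= p ->
  (Mtil N p)%:R <= expR 1 * N%:R * p * `|ln p| < (Mtil N p)%:R + 1.
Proof.
move=> p0; rewrite natr1; apply: truncn_itv.
by rewrite !mulr_ge0// expR_ge0.
Qed.

Section FixedP.
Variables (R : realType) (p : R).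
Hypothesis p01 : 0 < p < 1.
Let M n := Mtil n p.
Let a : R := expR 1 * p * `|ln p|.

Lemma norm_ln_gt0 : 0 < `|ln p|.
Proof. by rewrite normr_gt0 lt_eqF// ln_lt0. Qed.

Lemma Mtil_div_cvg : (fun n => (M n)%:R / n%:R) @ \oo --> a.
Proof.
have /andP[p0 p1] := p01.
apply: (@squeeze_cvgr _ _ _ _ (fun n => a - n%:R^-1) (fun=> a)); last exact: cvg_cst.
  near=> n.
  have n0 : 0 < n%:R :> R by rewrite ltr0n; near: n; exact: nbhs_infty_gt.
  have /andP[h1 h2] := Mtil_itv R n p (ltW p0).
  have aE : expR 1 * n%:R * p * `|ln p| = a * n%:R by rewrite /a; ring.
  rewrite aE in h1 h2.
  rewrite ler_pdivrMr// h1 andbT ler_pdivlMr// mulrBl mulVf ?gt_eqF//.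
  by rewrite lerBlDr ltW.
rewrite -[X in _ --> X]subr0; apply: cvgB; first exact: cvg_cst.
exact: cvgn_natV.
Unshelve. all: by end_near. Qed.

Lemma Mtil_rate_neq0 : a != 0.
Proof.
have /andP[p0 p1] := p01.
by rewrite gt_eqF// !mulr_gt0 ?expR_gt0// norm_ln_gt0.
Qed.

Lemma div_Mtil_cvg : cvgn (fun n => n%:R * ((Ltil p)%:R / (M n)%:R) : R).
Proof.
have -> : (fun n => n%:R * ((Ltil p)%:R / (M n)%:R) : R) =
    (fun n => (Ltil p)%:R * ((M n)%:R / n%:R)^-1).
  by apply/funext => n; rewrite invf_div mulrCA.
apply: is_cvgM; first exact: is_cvg_cst.
apply: cvgP; apply: cvgV; [exact: Mtil_rate_neq0 | exact: Mtil_div_cvg].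
Qed.

Lemma density_cvg0 : (fun n => (Ltil p)%:R / (M n)%:R : R) @ \oo --> (0 : R).
Proof.
have -> : (fun n => (Ltil p)%:R / (M n)%:R : R) =
    (fun n => n%:R * ((Ltil p)%:R / (M n)%:R) * n%:R^-1).
  (* At n = 0 both sides are 0, since [M 0] is 0 and so is its inverse. *)
  apply/funext => -[|n]; last by rewrite mulrAC mulfV ?mul1r// pnatr_eq0.
  by rewrite mul0r mul0r /M /Mtil mulr0 !mul0r truncn0 invr0 mulr0.
rewrite -[X in _ --> X](mulr0 (limn (fun n => n%:R * ((Ltil p)%:R / (M n)%:R) : R))).
by apply: cvgM; [exact: div_Mtil_cvg | exact: cvgn_natV].
Qed.

Lemma Mtil_ge (K : nat) : \forall n \near \oo, (K <= M n)%N.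
Proof.
have /andP[p0 p1] := p01.
have a0 : 0 < a by rewrite !mulr_gt0 ?expR_gt0// norm_ln_gt0.
near=> n; have /andP[_ h2] := Mtil_itv R n p (ltW p0).
have : (K.+1%:R : R) / a <= n%:R by near: n; exact: nbhs_infty_ger.
rewrite ler_pdivrMr// => h; rewrite -ltnS -(ltr_nat R) -natr1.
apply: le_lt_trans h2; apply: le_trans (_ : K.+1%:R <= _); first by rewrite ler_nat.
by apply: (le_trans h); rewrite le_eqVlt /a; apply/orP; left; apply/eqP; ring.
Unshelve. all: by end_near. Qed.

Lemma cvgn_avg_cost : cvgn (fun n => avg_cost n p).
Proof.
have /andP[p0 p1] := p01; have l0 := norm_ln_gt0.
have Mq : cvgn (fun n => (M n)%:R * ((Ltil p)%:R / (M n)%:R) : R).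
  apply: (@cvgn_near_eq _ _ (fun=> (Ltil p)%:R)); last exact: is_cvg_cst.
  near=> n; have M0 : (0 < M n)%N by near: n; exact: Mtil_ge.
  by rewrite mulrC divfK// pnatr_eq0 -lt0n.
have p01' : 0 <= p <= 1 by rewrite !ltW.
have c0 := @cvgn_mean_U0 R p (Ltil p) M p01' density_cvg0 Mq div_Mtil_cvg.
have c1 := @cvgn_mean_U1 R p (Ltil p) M p01' density_cvg0 Mq div_Mtil_cvg.
apply: (@cvgn_near_eq _ _ (fun n => ((M n)%:R / n%:R +
   (mean_U0 R n (M n) (Ltil p) p + mean_U1 R n (M n) (Ltil p) p)) * (p * `|ln p|)^-1)).
  near=> n; rewrite avg_costE -/(M n).
  have n0 : n%:R != 0 :> R by rewrite pnatr_eq0 -lt0n; near: n; exact: nbhs_infty_gt.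
  by field; rewrite n0 !gt_eqF.
apply: is_cvgM; last exact: is_cvg_cst.
apply: is_cvgD; first by apply: cvgP; exact: Mtil_div_cvg.
exact: is_cvgD.
Unshelve. all: by end_near. Qed.

(** At fixed p the number of tests grows without bound, so the bounds of [avg_cost_itv] hold
    eventually and pass to the limit. The assumption p <= 1/e gives |ln p| >= 1, hence L >= 1. *)
Lemma lim_avg_cost_itv : p <= expR (- 1) ->
  expR 1 <= limn (fun n => avg_cost n p) <= expR 1 + (expR 2 + 1) / `|ln p|.
Proof.
move=> pe; have /andP[p0 p1] := p01; have l0 := norm_ln_gt0.
have l1 : 1 <= `|ln p|.
  rewrite ltr0_norm ?ln_lt0// lerNr -[leRHS]expRK ler_ln// posrE expR_gt0//.
have L1 : (1 <= Ltil p)%N.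
  rewrite /Ltil truncn_gt_nat; apply: le_trans l1 _; rewrite ler_peMl//.
  by apply: le_trans (expR_ge1Dx _); lra.
have bnd : \forall n \near \oo, expR 1 - (n%:R * p * `|ln p|)^-1 <= avg_cost n p <=
    expR 1 + (expR 2 + 1) / `|ln p|.
  near=> n; apply: avg_cost_itv => //; first by near: n; exact: nbhs_infty_gt.
  by near: n; exact: Mtil_ge.
have ca := cvgn_avg_cost.
apply/andP; split; last first.
  by apply: limr_le => //; apply: filterS bnd => n /andP[].
have cl : (fun n => expR 1 - (n%:R * p * `|ln p|)^-1) @ \oo --> expR 1.
  rewrite -[X in _ --> X]subr0; apply: cvgB; first exact: cvg_cst.
  have -> : (fun n => (n%:R * p * `|ln p|)^-1) = (fun n => n%:R^-1 * (p * `|ln p|)^-1).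
    by apply/funext => n; rewrite -mulrA invfM.
  rewrite -(mul0r (p * `|ln p|)^-1); apply: cvgM; last exact: cvg_cst.
  exact: cvgn_natV.
rewrite -(cvg_lim _ cl)//; apply: ler_lim => //; first exact: cvgP cl.
by apply: filterS bnd => n /andP[].
Unshelve. all: by end_near. Qed.

End FixedP.

(** * The regime p = N^(-beta), and the conclusion *)

Lemma natM_powRE (R : realType) (beta : R) (n : nat) : (0 < n)%N ->
  n%:R * n%:R `^ (- beta) = expR ((1 - beta) * ln n%:R) :> R.
Proof.
move=> n0; have n0' : n%:R != 0 :> R by rewrite pnatr_eq0 -lt0n.
rewrite mulrBl mul1r expRD lnK ?posrE ?ltr0n//; congr (_ * _).
by rewrite /powR (negbTE n0') mulNr.
Qed.

(** L^3 is of order (ln n)^3, whereas M is of order n^(1 - beta) ln n. *)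
Lemma Mtil_ge_powR (R : realType) (beta : R) : 0 < beta < 1 ->
  \forall n \near \oo, (10 * Ltil ((n%:R : R) `^ (- beta)) ^ 3 <=
    Mtil n ((n%:R : R) `^ (- beta)))%N.
Proof.
move=> /andP[b0 b1]; near=> n; set p := n%:R `^ (- beta).
have n0 : (0 < n)%N by near: n; exact: nbhs_infty_gt.
have n0' : 0 < n%:R :> R by rewrite ltr0n.
set x := ln (n%:R : R).
have x0 : 0 <= x by rewrite ln_ge0// ler1n.
have b10 : 0 < 1 - beta by rewrite subr_gt0.
have c30 : 0 < (1 - beta) ^+ 3 by rewrite exprn_gt0.
(* After cancelling e beta x, the goal is 10 (e beta x)^2 <= exp((1 - beta) x). The cubic term z^3 /
   3! of exp suffices, and 60 = 10 * 3!. *)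
have xge : 60 * expR 1 ^+ 2 * beta ^+ 2 / (1 - beta) ^+ 3 <= x.
  rewrite -[leLHS]expRK ler_ln ?posrE ?expR_gt0//.
  by near: n; exact: nbhs_infty_ger.
rewrite ler_pdivrMr// in xge.
have lE : `|ln p| = beta * x.
  by rewrite /p ln_powR mulNr normrN ger0_norm// mulr_ge0// ltW.
have /andP[_ hM] := @Mtil_itv R n p (powR_ge0 _ _).
have /andP[hL _] : (Ltil p)%:R <= expR 1 * `|ln p| < (Ltil p).+1%:R.
  by apply: truncn_itv; rewrite mulr_ge0// expR_ge0.
rewrite -ltnS -(ltr_nat R) -natr1; apply: le_lt_trans hM.
rewrite natrM natrX.
apply: (@le_trans _ _ (10 * (expR 1 * (beta * x)) ^+ 3)).
  by rewrite ler_wpM2l// lerXn2r ?nnegrE// -?lE// mulr_ge0// expR_ge0.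
have -> : expR 1 * n%:R * p * `|ln p| = expR 1 * (beta * x) * (n%:R * p).
  by rewrite lE; ring.
have -> : 10 * (expR 1 * (beta * x)) ^+ 3 =
    expR 1 * (beta * x) * (10 * (expR 1 * (beta * x)) ^+ 2) by ring.
apply: ler_wpM2l; first by rewrite !mulr_ge0 ?expR_ge0// ltW.
rewrite natM_powRE// -/x.
apply: le_trans (@expR_ge1Dxn R ((1 - beta) * x) 2 (mulr_ge0 (ltW b10) x0)).
have -> : 3`!%:R = 6 :> R by [].
have := ler_wpM2l (sqr_ge0 x) xge.
have -> : x ^+ 2 * (60 * expR 1 ^+ 2 * beta ^+ 2) = 60 * (expR 1 * (beta * x)) ^+ 2 by ring.
have -> : x ^+ 2 * (x * (1 - beta) ^+ 3) = ((1 - beta) * x) ^+ 3 by ring.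
lra.
Unshelve. all: by end_near. Qed.

Theorem theorem5 (R : realType) (beta : R) (hb0 : 0 <= beta) (hb1 : beta < 1) :
  (* case beta > 0 : lim_{N -> oo} f(N, N^{-beta}) = e *)
  (0 < beta ->
     (fun N : nat => avg_cost N ((N%:R : R) `^ (- beta))) @ \oo --> expR (1 : R))
  /\
  (* case beta = 0 : lim_{p -> 0} lim_{N -> oo} f(N, p) = e *)
  (beta = 0 ->
     exists g : R -> R,
       (forall p : R, 0 < p < 1 -> (fun N : nat => avg_cost N p) @ \oo --> g p)
       /\ g x @[x --> 0^'+] --> expR (1 : R)).
Proof.
have K0 : 0 < expR 2 + 1 :> R by rewrite addr_gt0// expR_gt0.
split=> [b0|_]; last first.
  exists (fun p => limn (fun N => avg_cost N p)); split=> [p p01|].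
    exact: cvgn_avg_cost.
  apply/cvgrPdist_le => eps eps0; near=> p.
  have p0 : 0 < p by near: p; exact: nbhs_right_gt.
  (* This threshold meets the hypothesis of [lim_avg_cost_itv]; a second one, exp(-(e^2 + 1) / eps),
     is used at the end to make the error at most eps. *)
  have p1 : p < expR (- 1) by near: p; apply: nbhs_right_lt; exact: expR_gt0.
  have p01 : 0 < p < 1.
    by rewrite p0 (lt_le_trans p1)// -expR0 ler_expR; lra.
  have l0 := @norm_ln_gt0 R p p01.
  have /andP[h1 h2] := @lim_avg_cost_itv R p p01 (ltW p1).
  rewrite distrC ger0_norm ?subr_ge0// lerBlDl; apply: (le_trans h2); rewrite lerD2l.
  rewrite ler_pdivrMr// -ler_pdivrMl// mulrC.
  rewrite ltr0_norm ?ln_lt0// lerNr -[leRHS]expRK ler_ln ?posrE ?expR_gt0//.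
  by near: p; apply: nbhs_right_le; exact: expR_gt0.
have b01 : 0 < beta < 1 by rewrite b0.
apply/cvgrPdist_le => eps eps0; near=> n.
have : (10 * Ltil ((n%:R : R) `^ (- beta)) ^ 3 <= Mtil n ((n%:R : R) `^ (- beta)))%N.
  by near: n; exact: Mtil_ge_powR.
set p := n%:R `^ (- beta) => hM.
have n1 : (1 < n)%N by near: n; exact: nbhs_infty_gt.
have n0 : 0 < n%:R :> R by rewrite ltr0n ltnW.
(* The 1 in the maximum ensures |ln p| >= 1, hence L >= 1 and p < 1; the other entry makes the upper
   error at most eps. *)
have lnn : Num.max 1 ((expR 2 + 1) / eps) / beta <= ln (n%:R : R).
  rewrite -[leLHS]expRK ler_ln ?posrE ?expR_gt0//.
  by near: n; exact: nbhs_infty_ger.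
have lE : `|ln p| = beta * ln (n%:R : R).
  by rewrite /p ln_powR mulNr normrN ger0_norm// mulr_ge0// ln_ge0// ler1n ltnW.
move: lnn; rewrite ler_pdivrMr// [ln _ * _]mulrC -lE ge_max => /andP[l1 lK].
have p0 : 0 < p by rewrite powR_gt0.
have l0 : 0 < `|ln p| by apply: lt_le_trans l1.
have p01 : 0 < p < 1.
  rewrite p0/= ltNge; apply/negP => /ln_ge0; rewrite /p ln_powR mulNr -lE; lra.
have np1 : 1 <= n%:R * p.
  rewrite natM_powRE ?(ltnW n1)// -[leLHS]expR0 ler_expR mulr_ge0 ?subr_ge0 ?(ltW hb1)//.
  by rewrite ln_ge0// ler1n ltnW.
have L1 : (1 <= Ltil p)%N.
  rewrite /Ltil truncn_gt_nat; apply: le_trans l1 _; rewrite ler_peMl//.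
  by apply: le_trans (expR_ge1Dx _); lra.
have /andP[h1 h2] : expR 1 - (n%:R * p * `|ln p|)^-1 <= avg_cost n p <=
    expR 1 + (expR 2 + 1) / `|ln p|.
  by apply: avg_cost_itv; rewrite // ltnW.
have e1 : (expR 2 + 1) / `|ln p| <= eps.
  by rewrite ler_pdivrMr// -ler_pdivrMl// mulrC.
(* As n p >= 1, the lower error is at most 1 / |ln p|, which the upper error dominates. *)
have e2 : (n%:R * p * `|ln p|)^-1 <= eps.
  apply: le_trans e1; rewrite ler_pdivlMr// invfM -mulrA mulVf ?gt_eqF// mulr1.
  apply: (@le_trans _ _ 1); first by rewrite invf_le1//; exact: lt_le_trans np1.
  by rewrite lerDr expR_ge0.
rewrite ler_norml; apply/andP; split; lra.
Unshelve. all: by end_near. Qed.
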